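(* Let $n\ge0$ and $p\ge1$. (i) Let a system $W_{k+1}(\lambda)-W_k(\lambda)=-\frac i\lambda C_kW_k(\lambda)$ be given on the interval $0\le k\le n$ and satisfy conditions (D) of the context. Then a $p\times p$ matrix function $\varphi$ analytic at $\lambda=i$ is a Weyl function of this system if and only if it admits the expansion $$\varphi\Big(i\,\frac{1+z}{1-z}\Big)=-\psi_0+(\psi_0-\psi_1)z+\dots+(\psi_{n-1}-\psi_n)z^n+O(z^{n+1})\qquad(z\to0),$$ where the $p\times p$ matrices $\psi_0,\dots,\psi_n$ are defined from the system as in the context. (ii) Suppose $\varphi$ is a $p\times p$ matrix function analytic at $\lambda=i$. Then $\varphi$ is a Weyl function of some system $W_{k+1}(\lambda)-W_k(\lambda)=-\frac i\lambda C_kW_k(\lambda)$ given on the interval $0\le k\le n$ and satisfying conditions (D) if and only if the matrix $S$ uniquely defined by the identity $AS-SA^*=i\Pi\Pi^*$ is invertible. Here $A=A(n)$ is the matrix defined in the context and $\Pi=[\Phi_1\quad\Phi_2]$ with $$\Phi_1=\begin{bmatrix} I_p \\ I_p \\ \cdots \\ I_p \end{bmatrix},\qquad\Phi_2=-\begin{bmatrix} \alpha_0 \\ \alpha_0+\alpha_1 \\ \cdots \\ \alpha_0+\alpha_1+\dots+\alpha_n \end{bmatrix}$$ ($(n+1)p\times p$ matrices), where $\{\alpha_k\}$ are the Taylor coefficients of $\varphi\big(i\,\frac{1+z}{1-z}\big)$ at $z=0$.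
   Context: **Conditions (D)** on a system $W_{k+1}(\lambda)-W_k(\lambda)=-\frac i\lambda C_kW_k(\lambda)$, $0\le k\le n$: $C_k=C_k^*=C_k^{-1}$ and $$C_k=I_{2p}-2\beta(k)^*\beta(k),\qquad \beta(k)\beta(k)^*=I_p\qquad(0\le k\le n)$$ for some $p\times2p$ matrices $\beta(k)=[\beta_1(k)\quad\beta_2(k)]$ ($p\times p$ blocks) such that $$\det\beta_1(0)\ne0,\qquad\det\big(\beta(k-1)\beta(k)^*\big)\ne0\quad(0<k\le n).$$ **Weyl functions of the system on $0\le k\le n$.** Let $W_k(\lambda)$ be the $2p\times2p$ solution normalized by $W_0(\lambda)=I_{2p}$, and put $\mathcal W(\lambda)=\{\mathcal W_{ij}(\lambda)\}_{i,j=1}^2=W_{n+1}(\overline\lambda)^*$, with $p\times p$ blocks $\mathcal W_{ij}$. A pair $R,Q$ of $p\times p$ matrix functions analytic in a neighborhood of $\lambda=i$ is called admissible if $\det\big(\mathcal W_{21}(i)R(i)+\mathcal W_{22}(i)Q(i)\big)\ne0$. The Weyl functions of the system are the matrix functions (considered near $\lambda=i$) $$\varphi(\lambda)=\big(\mathcal W_{11}(\lambda)R(\lambda)+\mathcal W_{12}(\lambda)Q(\lambda)\big)\big(\mathcal W_{21}(\lambda)R(\lambda)+\mathcal W_{22}(\lambda)Q(\lambda)\big)^{-1}$$ with $R,Q$ admissible. **The matrix $A(r)$.** For $r\ge0$, $A(r)$ is the $(r+1)p\times(r+1)p$ block lower triangular matrix whose $p\times p$ blocks are $\frac i2I_p$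 on the main diagonal, $iI_p$ below the main diagonal, and $0$ above it. **The matrices $\psi_k$.** Define block lower triangular $(k+1)p\times(k+1)p$ matrices $V_-(k)$, $0\le k\le n$, recursively by $$V_-(0)=v_-(0)=\beta_1(0),\qquad V_-(k)=\begin{bmatrix} V_-(k-1) & 0 \\ X(k) & v_-(k) \end{bmatrix}\quad(k>0),$$ where $v_-(k)=\beta(k)\beta(k-1)^*v_-(k-1)$ and $X(k)=[X_0(k)\quad\widetilde X(k)]$ is a $p\times kp$ matrix with the $p\times(k-1)p$ part (absent for $k=1$) $$\widetilde X(k)=i\Big(\beta(k)[\beta(0)^*\ \ldots\ \beta(k-1)^*]V_-(k-1)\begin{bmatrix} I_{(k-1)p} \\ 0 \end{bmatrix}-v_-(k)[I_p\ \ldots\ I_p]\Big)\Big(A(k-2)+\frac i2I_{(k-1)p}\Big)^{-1}$$ and the $p\times p$ part $$X_0(k)=\beta_1(k)-v_-(k)-\widetilde X(k)\begin{bmatrix} I_p \\ \cdots \\ I_p \end{bmatrix}$$ (the last term being absent for $k=1$). The matrices $V_-(k)$ are invertible. Then $\psi_0,\dots,\psi_n$ are the $p\times p$ blocks of the $(n+1)p\times p$ matrix $$\Phi_2(n)=\begin{bmatrix} \psi_0 \\ \cdots \\ \psi_n \end{bmatrix}=V_-(n)^{-1}\begin{bmatrix} \beta_2(0) \\ \cdots \\ \beta_2(n) \end{bmatrix}.$$ *)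

(* Defs.v *)
From HB Require Import structures.
From mathcomp Require Export all_boot all_order all_algebra complex.
From mathcomp Require Export all_classical all_reals all_analysis.

Set Implicit Arguments.
Unset Strict Implicit.
Unset Printing Implicit Defensive.

Export Order.TTheory GRing.Theory Num.Theory numFieldNormedType.Exports.

Open Scope classical_set_scope.
Open Scope ring_scope.
Open Scope sesquilinear_scope.

(* Everything is defined over an arbitrary [K : numClosedFieldType], which
   carries a topology in MathComp-Analysis; the main statement takes
   K := R[i] with R : realType.  [M ^t*] is the conjugate transpose. *)

Section Analytic.
Variables (K : numClosedFieldType) (p : nat).

Definition power_series_at (f : K -> 'M[K]_p) (z0 : K) (a : nat -> 'M[K]_p) : Prop :=
  \forall z \near z0, series (fun k => (z - z0) ^+ k *: a k) @ \oo --> f z.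

Definition analytic_at (f : K -> 'M[K]_p) (z0 : K) : Prop := exists a, power_series_at f z0 a.

(* The coefficient sequence of a power series expansion is unique; when f is
   not analytic at z0 the value is a dummy. *)
Definition taylor_coef (f : K -> 'M[K]_p) (z0 : K) : nat -> 'M[K]_p :=
  xget (fun=> 0) [set a | power_series_at f z0 a].

Definition cayley_comp (f : K -> 'M[K]_p) (z : K) : 'M[K]_p := f ('i * ((1 + z) / (1 - z))).

End Analytic.

Section System.
Variables (K : numClosedFieldType) (p : nat).

Definition beta1 (beta : nat -> 'M[K]_(p, p + p)) k : 'M[K]_p :=
  lsubmx (beta k).
Definition beta2 (beta : nat -> 'M[K]_(p, p + p)) k : 'M[K]_p :=
  rsubmx (beta k).

(* Only the values C k, beta k with k <= n are relevant. *)
Definition conditions_D n (C : nat -> 'M[K]_(p + p))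
    (beta : nat -> 'M[K]_(p, p + p)) : Prop :=
  [/\ forall k, (k <= n)%N ->
        [/\ C k = (C k) ^t*, C k \in unitmx & C k = invmx (C k)],
      forall k, (k <= n)%N ->
        C k = 1%:M - 2%:R *: ((beta k) ^t* *m beta k)
        /\ beta k *m (beta k) ^t* = 1%:M,
      \det (beta1 beta 0) != 0
    & forall k, (0 < k <= n)%N ->
        \det (beta k.-1 *m (beta k) ^t*) != 0].

Fixpoint Wsol (C : nat -> 'M[K]_(p + p)) (k : nat) (l : K) : 'M[K]_(p + p) :=
  if k is k'.+1 then Wsol C k' l - ('i / l) *: (C k' *m Wsol C k' l)
  else 1%:M.

Definition calW n C (l : K) : 'M[K]_(p + p) := (Wsol C n.+1 l^*) ^t*.

Definition weyl_denom n C (r q : K -> 'M[K]_p) (l : K) : 'M[K]_p :=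
  dlsubmx (calW n C l) *m r l + drsubmx (calW n C l) *m q l.

Definition weyl_num n C (r q : K -> 'M[K]_p) (l : K) : 'M[K]_p :=
  ulsubmx (calW n C l) *m r l + ursubmx (calW n C l) *m q l.

Definition admissible n C (r q : K -> 'M[K]_p) : Prop :=
  [/\ analytic_at r 'i, analytic_at q 'i & \det (weyl_denom n C r q 'i) != 0].

Definition weyl_function n C (phi : K -> 'M[K]_p) : Prop :=
  exists r q, admissible n C r q /\
    \forall l \near ('i : K),
      phi l = weyl_num n C r q l *m invmx (weyl_denom n C r q l).

(* [Ablock m] has m block rows: the matrix A(r) is [Ablock r.+1]. *)
Definition Ablock m : 'M[K]_(\sum_(i < m) p) :=
  \mxblock_(i < m, j < m)
    (if (i == j :> nat) then ('i / 2%:R)%:M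
     else if (j < i)%N then 'i%:M else 0 : 'M[K]_p).

Definition block_ones m : 'M[K]_(\sum_(i < m) p, p) :=
  \mxcol_(i < m) (1%:M : 'M[K]_p).

Section VMinus.
Variable beta : nat -> 'M[K]_(p, p + p).

Fixpoint vminus k : 'M[K]_p :=
  if k is k'.+1 then beta k *m (beta k') ^t* *m vminus k' else beta1 beta 0.

(* In the next three definitions the block row k = m.+1 of V_-(k) is built
   from V = V_-(m); its part Xtilde has m = k - 1 blocks. *)
Definition Xtilde m (V : 'M[K]_(\sum_(i < m.+1) p)) :
    'M[K]_(p, \sum_(j < m) p) :=
  'i *: ((beta m.+1 *m (\mxrow_(j < m.+1) (beta j) ^t*) *m V
            *m (\mxblock_(i < m.+1, j < m)
                  (if (i == j :> nat) then 1%:M else 0 : 'M[K]_p))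
          - vminus m.+1 *m (\mxrow_(j < m) (1%:M : 'M[K]_p)))
         *m invmx (Ablock m + ('i / 2%:R)%:M)).

Definition X0 m (V : 'M[K]_(\sum_(i < m.+1) p)) : 'M[K]_p :=
  beta1 beta m.+1 - vminus m.+1 - Xtilde V *m block_ones m.

Definition Xrow m (V : 'M[K]_(\sum_(i < m.+1) p)) :
    'M[K]_(p, \sum_(j < m.+1) p) :=
  \mxrow_(j < m.+1)
    (if unlift ord0 j is Some j' then submxrow (Xtilde V) j' else X0 V).

(* [unlift ord_max i] is [None] exactly for the last block index. *)
Fixpoint Vminus k : 'M[K]_(\sum_(i < k.+1) p) :=
  match k with
  | 0 => \mxblock_(i < 1, j < 1) (vminus 0)
  | m.+1 => \mxblock_(i < m.+2, j < m.+2)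
      match unlift ord_max i, unlift ord_max j with
      | Some i', Some j' => submxblock (Vminus m) i' j'
      | Some _, None => 0
      | None, Some j' => submxrow (Xrow (Vminus m)) j'
      | None, None => vminus m.+1
      end
  end.

(* Under conditions (D) every v_-(k), hence Vminus n, is invertible, so that
   invmx is the genuine inverse. *)
Definition psi n (k : nat) : 'M[K]_p :=
  submxcol (invmx (Vminus n) *m \mxcol_(j < n.+1) beta2 beta j) (inord k).

End VMinus.

Definition weyl_expansion n beta (phi : K -> 'M[K]_p) : Prop :=
  (fun z : K => cayley_comp phi z
     - (- psi beta n 0
        + \sum_(1 <= k < n.+1) z ^+ k *: (psi beta n k.-1 - psi beta n k)))
  =O_ (0 : K) (fun z : K => z ^+ n.+1).

Definition Phi2 n (a : nat -> 'M[K]_p) : 'M[K]_(\sum_(i < n.+1) p, p) :=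
  - \mxcol_(i < n.+1) \sum_(j < i.+1) a j.

Definition Pi n (a : nat -> 'M[K]_p) : 'M[K]_(\sum_(i < n.+1) p, p + p) :=
  row_mx (block_ones n.+1) (Phi2 n a).

Definition S_identity n (a : nat -> 'M[K]_p)
    (S : 'M[K]_(\sum_(i < n.+1) p)) : Prop :=
  Ablock n.+1 *m S - S *m (Ablock n.+1) ^t* = 'i *: (Pi n a *m (Pi n a) ^t*).

End System.

(* Main.v *)
Require Import Defs.
From mathcomp Require Import ring.

Set Implicit Arguments.
Unset Strict Implicit.
Unset Printing Implicit Defensive.

(* Put P_k = beta(k)^* beta(k) and z = (l - i) / (l + i).  Since C_k = 1 - 2 P_k is an
   involution, l + i C_k = (l + i) ((1 - P_k) + z P_k), and l^(n+1) calW(l) is the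
   product of these factors; its inverse is, up to ((l - i)(l + i))^(n+1), the
   reversed product of the factors l - i C_k.  Hence phi is a Weyl function iff
   the reversed product sends [phi; 1] to a function divisible by (l - i)^(n+1).

   (i) The relations defining V_- say that V_- intertwines the strictly lower
   triangular all-ones matrix with the strictly lower triangular part of the Gram
   matrix (beta(k) beta(j)^* ), and that V_- [Phi_1 Phi_2] = (beta(k))_k.  They yield
   an explicit polynomial h with prod_k ((1 - P_k) + z P_k) h = [psi_poly; 1], so
   psi_poly satisfies the criterion.  Conversely beta(n) times the reversed product
   annihilates the full product to order n + 1, and at l = i its left block is
   (2i)^(n+1) v_-(n), which is invertible: this forces phi = psi_poly + O(z^(n+1)).

   (ii) Both sides always hold.  S is self-adjoint; its kernel is invariant under A
   and orthogonal to the range of Phi_1, and A, Phi_1 form a controllable pair, so S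
   is invertible.  On the other hand every phi is a Weyl function: starting from
   g_0 = [phi; 1], choose for beta(k) an orthonormal basis of the left annihilator
   of g_k(i) and set g_{k+1} = (l + i)(l + i C_k)^-1 g_k. *)

(** * Power series with matrix coefficients *)

Section MatrixNorm.
Variable K : numFieldType.

Lemma mx_norm_entry m q (M : 'M[K]_(m, q)) i j : `|M i j| <= `|M|.
Proof.
rewrite {2}/Num.norm /= mx_normE -[leLHS]nngE num_le.
exact: (le_bigmax _ (fun ij : 'I_m * 'I_q => `|M ij.1 ij.2|%:nng) (i, j)).
Qed.

Lemma mx_norm_le m q (M : 'M[K]_(m, q)) c :
  0 <= c -> (forall i j, `|M i j| <= c) -> `|M| <= c.
Proof.
move=> c0 Mc; have [->|] := eqVneq `|M| 0; first by [].
by move=> /mx_norm_neq0 [[i j]] /= H; rewrite {1}/Num.norm /= H.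
Qed.

(** The norm is the largest modulus of an entry, hence not submultiplicative: an entry of the
    product is a sum of q terms. *)
Lemma mx_norm_mul m q r (A : 'M[K]_(m, q)) (B : 'M[K]_(q, r)) :
  `|A *m B| <= q%:R * `|A| * `|B|.
Proof.
apply: mx_norm_le => [|i j]; first by rewrite !mulr_ge0.
rewrite mxE (le_trans (ler_norm_sum _ _ _))//.
rewrite -mulrA mulr_natl -[X in _ <= _ *+ X]card_ord -sumr_const.
by apply: ler_sum => k _; rewrite normrM ler_pM ?mx_norm_entry.
Qed.

Lemma cvg_mulmx m q r (A : 'M[K]_(m, q)) (u : nat -> 'M[K]_(q, r)) l :
  u @ \oo --> l -> (fun k => A *m u k) @ \oo --> A *m l.
Proof.
move=> /cvgrPdist_le ul; apply/cvgrPdist_le => e e0.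
have cp : 0 < q%:R * `|A| + 1 by rewrite ltr_wpDl ?mulr_ge0.
near=> k; rewrite -mulmxBr (le_trans (mx_norm_mul _ _))//.
have : `|l - u k| <= e / (q%:R * `|A| + 1) by near: k; apply: ul; rewrite divr_gt0.
rewrite ler_pdivlMr// mulrC => /(le_trans _); apply.
by rewrite ler_wpM2r// lerDl.
Unshelve. all: end_near. Qed.

End MatrixNorm.

Section PowerSeries.
Variable K : numFieldType.

(** Convertible to [power_series_at] for square matrices; rectangular shapes serve for columns such
    as [phi; 1]. *)
Definition power_series_mx m q (f : K -> 'M[K]_(m, q)) (z0 : K) a : Prop :=
  \forall z \near z0, series (fun k => (z - z0) ^+ k *: a k) @ \oo --> f z.

Definition analytic_mx m q (f : K -> 'M[K]_(m, q)) z0 : Prop :=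
  exists a, power_series_mx f z0 a.

(** The bound includes the point z0 itself: k = 0 means boundedness near z0, and k > 0 forces f z0 =
    0. *)
Definition order_ge m q k (f : K -> 'M[K]_(m, q)) (z0 : K) : Prop :=
  exists2 c, 0 <= c & \forall z \near z0, `|f z| <= c * `|z - z0| ^+ k.

Lemma power_series_mx_at0 m q (f : K -> 'M[K]_(m, q)) z0 a :
  power_series_mx f z0 a -> f z0 = a 0.
Proof.
move=> /nbhs_singleton fa; apply: (cvg_unique (@norm_hausdorff _ _) fa).
(* At z0 the partial sums equal [a 0] only from index 1 on; the one of index 0 is empty. *)
rewrite /mkset -cvg_shiftS.
apply: (@cvg_near_cst nat); near=> k => /=.
rewrite /series /= big_mkord big_ord_recl expr0 scale1r big1 ?addr0// => i _.
by rewrite subrr expr0n scale0r.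
Unshelve. all: end_near. Qed.

Lemma analytic_mx_ext m q (f g : K -> 'M[K]_(m, q)) z0 :
  f =1 g -> analytic_mx f z0 -> analytic_mx g z0.
Proof. by move=> /funext ->. Qed.

Lemma analytic_mx_cst m q (A : 'M[K]_(m, q)) z0 : analytic_mx (fun=> A) z0.
Proof.
exists (fun k => if k is 0 then A else 0); near=> z.
rewrite -cvg_shiftS; apply: (@cvg_near_cst nat); near=> k => /=.
rewrite /series /= big_mkord big_ord_recl expr0 scale1r big1 ?addr0// => i _.
by rewrite scaler0.
Unshelve. all: end_near. Qed.

Lemma analytic_mxD m q (f g : K -> 'M[K]_(m, q)) z0 :
  analytic_mx f z0 -> analytic_mx g z0 -> analytic_mx (fun z => f z + g z) z0.
Proof.
move=> [a fa] [b gb]; exists (fun k => a k + b k); near=> z.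
have -> : series (fun k => (z - z0) ^+ k *: (a k + b k)) =
  series (fun k => (z - z0) ^+ k *: a k) + series (fun k => (z - z0) ^+ k *: b k).
  by rewrite -seriesD; congr series; apply/funext => k; rewrite scalerDr.
by apply: cvgD; near: z.
Unshelve. all: end_near. Qed.

(** Re-expanded at z0 the pencil is (z - z0) A + B', so the new coefficients are B' a_k + A a_(k-1)
    and no Cauchy product is involved. The transfer products below are built from such pencils. *)
Lemma analytic_mx_affine m q r (A B : 'M[K]_(m, q)) (f : K -> 'M[K]_(q, r)) z0 :
  analytic_mx f z0 -> analytic_mx (fun z => (z *: A + B) *m f z) z0.
Proof.
move=> [a fa]; pose B' := z0 *: A + B.
exists (fun k => B' *m a k + (if k is j.+1 then A *m a j else 0)); near=> z.
have cf : series (fun k => (z - z0) ^+ k *: a k) @ \oo --> f z by near: z.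
rewrite -cvg_shiftS.
have -> : (z *: A + B) *m f z = B' *m f z + ((z - z0) *: A) *m f z.
  by rewrite -mulmxDl /B' scalerBl [z *: A - _]addrC addrACA subrr add0r addrC.
have E : (fun k => series (fun k => (z - z0) ^+ k *:
    (B' *m a k + (if k is j.+1 then A *m a j else 0))) k.+1) =
  (fun k => B' *m series (fun k => (z - z0) ^+ k *: a k) k.+1) +
  (fun k => ((z - z0) *: A) *m series (fun k => (z - z0) ^+ k *: a k) k).
  apply/funext => k; rewrite /series /= -[RHS]/(_ + _) !big_mkord.
  under eq_bigr do rewrite scalerDr.
  rewrite big_split /= mulmx_sumr; congr (_ + _).
    by apply: eq_bigr => i _; rewrite -scalemxAr.
  rewrite big_ord_recl scaler0 add0r mulmx_sumr; apply: eq_bigr => i _.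
  by rewrite exprS -scalemxAl -scalemxAr scalerA.
rewrite E.
apply: cvgD; last exact: cvg_mulmx.
apply: cvg_mulmx.
have := cf; rewrite -(cvg_shiftS (series _)); exact.
Unshelve. all: end_near. Qed.

Lemma analytic_mx_mulr m q r (A : 'M[K]_(m, q)) (f : K -> 'M[K]_(q, r)) z0 :
  analytic_mx f z0 -> analytic_mx (fun z => A *m f z) z0.
Proof.
move=> /(analytic_mx_affine 0 A); apply: analytic_mx_ext => z.
by rewrite scaler0 add0r.
Qed.

Lemma analytic_mx_sum m q (I : Type) (s : seq I) (f : I -> K -> 'M[K]_(m, q)) z0 :
  (forall i, analytic_mx (f i) z0) -> analytic_mx (fun z => \sum_(i <- s) f i z) z0.
Proof.
move=> fa; elim: s => [|i s IH].
  have -> : (fun z => \sum_(i <- [::]) f i z) = (fun=> 0).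
    by apply/funext => z; rewrite big_nil.
  exact: analytic_mx_cst.
have -> : (fun z => \sum_(j <- i :: s) f j z) =
    (fun z => f i z + \sum_(j <- s) f j z).
  by apply/funext => z; rewrite big_cons.
exact: analytic_mxD.
Qed.

Lemma near_dist_le (z0 e : K) : 0 < e -> \forall z \near z0, `|z - z0| <= e.
Proof.
by move=> e0; apply/nbhs_ballP; exists e => //= z; rewrite /ball /= distrC => /ltW.
Qed.

(** Convergence at the single point z0 + t bounds all terms t^k a_k by some M; for |z - z0| <= t / 2
    the terms of positive index are then dominated by a geometric series of ratio 1/2. *)
Lemma power_series_mx_sub m q (f : K -> 'M[K]_(m, q)) z0 a :
  power_series_mx f z0 a -> order_ge 1 (fun z => f z - a 0) z0.
Proof.
move=> fa; have /nbhs_ballP [e /= e0 fe] := fa.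
pose t := e / 2; have t0 : 0 < t by rewrite divr_gt0.
have : series (fun k => t ^+ k *: a k) @ \oo --> f (z0 + t).
  have := fe (z0 + t); rewrite addrAC subrr add0r; apply.
  by rewrite /ball /= opprD addrA subrr sub0r normrN gtr0_norm// ltr_pdivrMr// ltr_pMr// ltr1n.
move=> /cvgP/cvg_series_cvg_0/cvgP/cvg_seq_bounded/pinfty_ex_gt0 [M M0 /= Mt].
have {}Mt k : `|t ^+ k *: a k| <= M by exact: Mt.
exists (2 * M / t); first by rewrite divr_ge0 ?mulr_ge0 ?ltW.
near=> z; set x := `|z - z0| / t.
have xt : `|z - z0| = x * t by rewrite divfK// gt_eqF.
have x0 : 0 <= x by rewrite divr_ge0// ltW.
have x2 : x <= 1 / 2.
  by rewrite ler_pdivrMr//; near: z; apply: near_dist_le; rewrite mulr_gt0.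
have fz : series (fun k => (z - z0) ^+ k *: a k) @ \oo --> f z by near: z.
have S N : `|series (fun k => (z - z0) ^+ k *: a k) N.+1 - a 0| <= 2 * M * x.
  rewrite /series /= big_mkord big_ord_recl expr0 scale1r addrC addKr.
  have -> : \sum_(i < N) (z - z0) ^+ bump 0 i *: a (bump 0 i) =
    \sum_(i < N) (z - z0) ^+ i.+1 *: a i.+1 by [].
  (* The factor 1 - (1/2)^N of the finite geometric sum makes the induction on N go through. *)
  suff : `|\sum_(i < N) (z - z0) ^+ i.+1 *: a i.+1| <= 2 * M * x * (1 - (1 / 2) ^+ N).
    move=> /le_trans; apply; apply: ler_piMr; last by rewrite gerBl exprn_ge0.
    by apply: mulr_ge0 => //; apply: mulr_ge0 => //; exact: ltW.
  elim: N => [|N IH]; first by rewrite big_ord0 normr0 expr0 subrr mulr0.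
  rewrite big_ord_recr /= (le_trans (ler_normD _ _))//.
  have : `|(z - z0) ^+ N.+1 *: a N.+1| <= M * (x * (1 / 2) ^+ N).
    rewrite normrZ normrX xt exprMn -(gtr0_norm (exprn_gt0 N.+1 t0)) -mulrA -normrZ.
    rewrite mulrC ler_pM ?exprn_ge0// exprS ler_wpM2l//.
    by apply: lerXn2r => //; rewrite nnegrE ?divr_ge0.
  move=> /(lerD IH) /le_trans; apply; rewrite exprS.
  by rewrite le_eqVlt; apply/orP; left; apply/eqP; field.
suff : `|f z - a 0| <= 2 * M * x by rewrite expr1 /x mulrA mulrAC.
apply/ler_addgt0Pr => e1 e10.
move: fz; rewrite -cvg_shiftS => /cvgrPdist_le /(_ _ e10) /filter_ex [N /= fN].
have -> : f z - a 0 = (f z - series (fun k => (z - z0) ^+ k *: a k) N.+1) +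
  (series (fun k => (z - z0) ^+ k *: a k) N.+1 - a 0) by rewrite addrA subrK.
by rewrite addrC (le_trans (ler_normD _ _))// lerD// S.
Unshelve. all: end_near. Qed.

End PowerSeries.

(** * Order of vanishing of analytic matrix functions *)

Section VanishingOrder.
Variable K : numFieldType.

Lemma order_geD m q k (f g : K -> 'M[K]_(m, q)) z0 :
  order_ge k f z0 -> order_ge k g z0 -> order_ge k (fun z => f z + g z) z0.
Proof.
move=> [c c0 fc] [d d0 gd]; exists (c + d); first exact: addr_ge0.
near=> z; rewrite mulrDl (le_trans (ler_normD _ _))// lerD//.
  by near: z.
by near: z.
Unshelve. all: end_near. Qed.

Lemma order_ge_mul m q r k l (f : K -> 'M[K]_(m, q)) (g : K -> 'M[K]_(q, r)) z0 :
  order_ge k f z0 -> order_ge l g z0 -> order_ge (k + l) (fun z => f z *m g z) z0.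
Proof.
move=> [c c0 fc] [d d0 gd]; exists (q%:R * c * d); first by rewrite !mulr_ge0.
near=> z; rewrite (le_trans (mx_norm_mul _ _))// -!mulrA ler_wpM2l//.
have -> : c * (d * `|z - z0| ^+ (k + l)) =
  (c * `|z - z0| ^+ k) * (d * `|z - z0| ^+ l) by rewrite exprD; ring.
rewrite ler_pM//.
  by near: z.
by near: z.
Unshelve. all: end_near. Qed.

Lemma order_ge_near m q k (f g : K -> 'M[K]_(m, q)) z0 :
  (\forall z \near z0, f z = g z) -> order_ge k f z0 -> order_ge k g z0.
Proof.
move=> fg [c c0 fc]; exists c => //; near=> z.
rewrite (_ : g z = f z); first by near: z.
by apply/esym; near: z.
Unshelve. all: end_near. Qed.

Lemma analytic_mx_bounded m q (f : K -> 'M[K]_(m, q)) z0 :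
  analytic_mx f z0 -> order_ge 0 f z0.
Proof.
move=> [a /power_series_mx_sub [c c0 fc]]; exists (c + `|a 0|); first exact: addr_ge0.
near=> z; rewrite expr0 mulr1 -[f z](subrK (a 0)) (le_trans (ler_normD _ _))// lerD//.
apply: (@le_trans _ _ (c * `|z - z0| ^+ 1)); first by near: z.
by rewrite ler_piMr// expr1; near: z; apply: near_dist_le.
Unshelve. all: end_near. Qed.

Lemma order_ge1_small m q (f : K -> 'M[K]_(m, q)) z0 e :
  0 < e -> order_ge 1 f z0 -> \forall z \near z0, `|f z| <= e.
Proof.
move=> e0 [c c0 fc]; have c1 : 0 < c + 1 by rewrite ltr_wpDl.
near=> z; apply: (@le_trans _ _ (c * `|z - z0| ^+ 1)); first by near: z.
rewrite expr1; apply: (@le_trans _ _ ((c + 1) * `|z - z0|)).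
  by rewrite ler_wpM2r// lerDl.
rewrite mulrC -ler_pdivlMr//; near: z; apply: near_dist_le; exact: divr_gt0.
Unshelve. all: end_near. Qed.

(** For k > 0 the bound tends to 0, so continuity of f gives f z0 = 0. The inequality on the
    constant [f z0] is read off at one point of the punctured neighbourhood, whose filter is
    proper. *)
Lemma order_ge_punctured m q k (f : K -> 'M[K]_(m, q)) z0 c :
  analytic_mx f z0 -> 0 <= c ->
  (\forall z \near z0, z != z0 -> `|f z| <= c * `|z - z0| ^+ k) ->
  order_ge k f z0.
Proof.
move=> fa c0 fc; case: k fc => [|k] fc; first exact: analytic_mx_bounded.
suff f0 : f z0 = 0.
  exists c => //; near=> z; have [->|zz0] := eqVneq z z0.
    by rewrite f0 normr0 mulr_ge0.
  by move: zz0; near: z.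
apply/eqP; rewrite -normr_le0; apply/ler_addgt0Pr => e e0; rewrite add0r.
have [a fpa] := fa; have f0a := power_series_mx_at0 fpa.
have small := @order_ge1_small _ _ _ z0 (e / 2) _ (power_series_mx_sub fpa).
have c1 : 0 < c + 1 by rewrite ltr_wpDl.
have d0 : 0 < e / 2 / (c + 1) by rewrite !divr_gt0.
have e2 : 0 < e / 2 by rewrite divr_gt0.
have : \forall z \near z0^', `|f z0| <= e.
  near=> z.
  have -> : f z0 = f z - (f z - a 0) by rewrite -f0a subKr.
  rewrite (le_trans (ler_normB _ _))// [e]splitr lerD//; last first.
    by near: z; apply: nbhs_dnbhs; exact: small.
  have zz0 : z != z0 by near: z; exact: nbhs_dnbhs_neq.
  apply: (@le_trans _ _ (c * `|z - z0| ^+ k.+1)).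
    by move: zz0; near: z; apply: nbhs_dnbhs.
  have z1 : `|z - z0| <= 1 by near: z; apply: nbhs_dnbhs; apply: near_dist_le.
  have zd : `|z - z0| <= e / 2 / (c + 1).
    by near: z; apply: nbhs_dnbhs; apply: near_dist_le.
  apply: (@le_trans _ _ ((c + 1) * `|z - z0|)).
    rewrite ler_pM ?exprn_ge0 ?lerDl// exprS ler_piMr// exprn_ile1//.
  by rewrite mulrC -ler_pdivlMr.
by move=> /filter_ex [].
Unshelve. all: end_near. Qed.

(** The difference satisfies the punctured bound with constant 0, hence also vanishes at z0. *)
Lemma analytic_mx_eq m q (f g : K -> 'M[K]_(m, q)) z0 :
  analytic_mx f z0 -> analytic_mx g z0 ->
  (\forall z \near z0, z != z0 -> f z = g z) -> \forall z \near z0, f z = g z.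
Proof.
move=> fa ga fg; have da := analytic_mxD fa (analytic_mx_mulr (- 1%:M) ga).
have /(order_ge_punctured da (lexx 0)) : \forall z \near z0, z != z0 ->
    `|f z + - 1%:M *m g z| <= 0 * `|z - z0| ^+ 1.
  near=> z => zz0; rewrite mulNmx mul1mx (_ : f z = g z) ?subrr ?normr0 ?mul0r//.
  by move: zz0; near: z.
move=> [c c0 /nbhs_singleton]; rewrite subrr normr0 expr1 mulr0 normr_le0.
rewrite mulNmx mul1mx subr_eq0 => /eqP fg0; near=> z.
by have [->//|] := eqVneq z z0; near: z.
Unshelve. all: end_near. Qed.

Lemma analytic_mx_divide m q (f : K -> 'M[K]_(m, q)) z0 a :
  power_series_mx f z0 a -> f z0 = 0 ->
  exists g, [/\ analytic_mx g z0, g z0 = a 1 &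
    \forall z \near z0, f z = (z - z0) *: g z].
Proof.
move=> fa f0; have a0 : a 0 = 0 by rewrite -(power_series_mx_at0 fa).
exists (fun z => if z == z0 then a 1 else (z - z0)^-1 *: f z).
rewrite eqxx; split => //; last first.
  near=> z; case: eqVneq => [->|zz0]; first by rewrite f0 subrr scale0r.
  by rewrite scalerA divff ?scale1r// subr_eq0.
exists (fun k => a k.+1); near=> z; case: eqVneq => [->|zz0].
  rewrite -cvg_shiftS; apply: (@cvg_near_cst nat); near=> k => /=.
  rewrite /series /= big_mkord big_ord_recl expr0 scale1r big1 ?addr0// => i _.
  by rewrite subrr expr0n scale0r.
have : series (fun k => (z - z0) ^+ k *: a k) @ \oo --> f z by near: z.
rewrite -cvg_shiftS => /(cvg_mulmx (A := (z - z0)^-1%:M)).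
rewrite mul_scalar_mx; apply: cvg_trans; apply: near_eq_cvg; near=> k.
rewrite mul_scalar_mx /series /= !big_mkord big_ord_recl a0 scaler0 add0r scaler_sumr.
apply: eq_bigr => i _; rewrite exprS scalerA mulKf ?subr_eq0//.
Unshelve. all: end_near. Qed.

Lemma order_ge_divide m q k (f : K -> 'M[K]_(m, q)) z0 :
  analytic_mx f z0 -> order_ge k f z0 ->
  exists2 g, analytic_mx g z0 & \forall z \near z0, f z = (z - z0) ^+ k *: g z.
Proof.
elim: k f => [|k IH] f fa fk.
  by exists f => //; near=> z; rewrite expr0 scale1r.
have f0 : f z0 = 0.
  apply/eqP; rewrite -normr_le0; case: fk => c _ /nbhs_singleton.
  by rewrite subrr normr0 expr0n mulr0.
have [a fpa] := fa; have [g [ga _ fg]] := analytic_mx_divide fpa f0.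
have [c c0 fc] := fk.
(* Cancelling one factor |z - z0| yields the bound for g off z0 only, which suffices because g is
   analytic. *)
have [|h ha gh] := IH g ga.
  apply: (order_ge_punctured ga c0); near=> z => zz0.
  have t0 : 0 < `|z - z0| by rewrite normr_gt0 subr_eq0.
  rewrite -(ler_pM2l t0) -normrZ mulrCA -exprS.
  by rewrite -(_ : f z = (z - z0) *: g z); near: z.
exists h => //; near=> z; rewrite exprS -scalerA -(_ : g z = (z - z0) ^+ k *: h z).
  by near: z.
by near: z.
Unshelve. all: end_near. Qed.

(** In X = U0^-1 V X - U0^-1 (V - U0) X the last term has norm at most |X| / 2 and is absorbed in
    the left-hand side. *)
Lemma mx_norm_perturb m q (U0 V : 'M[K]_m) (X : 'M[K]_(m, q)) :
  U0 \in unitmx -> m%:R * `|invmx U0 *m (V - U0)| <= 1 / 2 ->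
  `|X| <= 2 * (m%:R * `|invmx U0| * `|V *m X|).
Proof.
move=> U0u small.
have XE : X = invmx U0 *m (V *m X) - (invmx U0 *m (V - U0)) *m X.
  by rewrite -mulmxA -mulmxBr -mulmxBl opprB addrC subrK mulKmx.
have : `|X| <= m%:R * `|invmx U0| * `|V *m X| + 1 / 2 * `|X|.
  rewrite {1}XE (le_trans (ler_normB _ _))// lerD ?mx_norm_mul//.
  by rewrite (le_trans (mx_norm_mul _ _))// ler_wpM2r.
rewrite -lerBlDr -{1}[`|X|]mul1r -mulrBl.
have -> : (1 - 1 / 2 : K) = 2^-1 by field.
by rewrite mulrC ler_pdivrMr// mulrC.
Qed.

Lemma near_perturb m (U : K -> 'M[K]_m) z0 :
  analytic_mx U z0 -> \forall z \near z0,
    m%:R * `|invmx (U z0) *m (U z - U z0)| <= 1 / 2.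
Proof.
move=> [a Ua]; rewrite (power_series_mx_at0 Ua).
have m1 : 0 < m%:R + 1 :> K by rewrite ltr_wpDl.
have [c c0 Uc] := order_ge_mul (analytic_mx_bounded (analytic_mx_cst (invmx (a 0)) z0))
   (power_series_mx_sub Ua).
have : order_ge 1 (fun z => invmx (a 0) *m (U z - a 0)) z0 by exists c.
move=> /(@order_ge1_small _ _ _ _ (1 / 2 / (m%:R + 1))) small.
near=> z; apply: (@le_trans _ _ ((m%:R + 1) * `|invmx (a 0) *m (U z - a 0)|)).
  by rewrite ler_wpM2r// lerDl.
by rewrite mulrC -ler_pdivlMr//; near: z; apply: small; rewrite !divr_gt0.
Unshelve. all: end_near. Qed.

(** [mx_norm_perturb] applied to the cokernel of U z, which U z annihilates, shows that it is
    zero. *)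
Lemma near_unitmx m (U : K -> 'M[K]_m) z0 :
  analytic_mx U z0 -> U z0 \in unitmx -> \forall z \near z0, U z \in unitmx.
Proof.
move=> Ua U0; near=> z; rewrite -row_full_unit -cokermx_eq0 -normr_le0.
rewrite (le_trans (mx_norm_perturb (V := U z) _ U0 _))//; first by near: z; exact: near_perturb.
by rewrite mulmx_coker normr0 !mulr0.
Unshelve. all: end_near. Qed.

(** Analyticity is asked of U alone, so f may be a pointwise inverse such as
    [fun l => invmx (D l)]. *)
Lemma order_ge_cancel m q k (U : K -> 'M[K]_m) (f : K -> 'M[K]_(m, q)) z0 :
  analytic_mx U z0 -> U z0 \in unitmx ->
  order_ge k (fun z => U z *m f z) z0 -> order_ge k f z0.
Proof.
move=> Ua U0 [c c0 Uf]; exists (2 * (m%:R * `|invmx (U z0)| * c)); first by rewrite !mulr_ge0.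
near=> z; rewrite (le_trans (mx_norm_perturb (V := U z) _ U0 _))//.
  by near: z; exact: near_perturb.
by rewrite -!mulrA !ler_wpM2l//; near: z.
Unshelve. all: end_near. Qed.

End VanishingOrder.

(** * The operator identity *)

Section ConjTranspose.
Variable K : numClosedFieldType.

Lemma trmxC_mul m q r (A : 'M[K]_(m, q)) (B : 'M[K]_(q, r)) :
  (A *m B) ^t* = B ^t* *m A ^t*.
Proof. by rewrite trmx_mul map_mxM. Qed.

Lemma trmxCD m q (A B : 'M[K]_(m, q)) : (A + B) ^t* = A ^t* + B ^t*.
Proof. by rewrite linearD /= map_mxD. Qed.

Lemma trmxCB m q (A B : 'M[K]_(m, q)) : (A - B) ^t* = A ^t* - B ^t*.
Proof. by rewrite linearB /= map_mxB. Qed.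

Lemma trmxCZ m q (c : K) (A : 'M[K]_(m, q)) : (c *: A) ^t* = c^* *: A ^t*.
Proof. by rewrite linearZ /= map_mxZ. Qed.

Lemma trmxC1 m : (1%:M : 'M[K]_m) ^t* = 1%:M.
Proof. by rewrite trmx1 map_mx1. Qed.

Lemma mulmx_trmxC_eq0 m q (M : 'M[K]_(m, q)) : M *m M ^t* = 0 -> M = 0.
Proof.
move=> M0; apply/matrixP => i j; rewrite [RHS]mxE; apply/eqP.
have /matrixP /(_ i i) := M0; rewrite !mxE => /eqP.
under eq_bigr do rewrite !mxE -normCK.
rewrite psumr_eq0; last by move=> k _; rewrite exprn_ge0.
by move=> /allP /(_ j); rewrite mem_index_enum => /(_ isT) /implyP /(_ isT);
  rewrite sqrf_eq0 normr_eq0.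
Qed.
End ConjTranspose.

Section Sylvester.
Variables (K : numClosedFieldType) (p : nat).

Definition Acoef (i j : nat) : K :=
  if i == j then 'i / 2%:R else if (j < i)%N then 'i else 0.

Lemma AblockE m : Ablock K p m = \mxblock_(i < m, j < m) ((Acoef i j)%:M : 'M[K]_p).
Proof.
apply/eq_mxblockP => i j; rewrite /Acoef; case: eqP => // _.
by case: ltnP => // _; rewrite raddf0.
Qed.


Lemma trmxC_AblockE m :
  (Ablock K p m) ^t* = \mxblock_(i < m, j < m) (((Acoef j i)^*)%:M : 'M[K]_p).
Proof.
rewrite AblockE tr_mxblock; apply/mxblockP => i j; rewrite mxblockK.
apply/matrixP => k l; rewrite mxE [LHS]mxE.
have /matrixP /(_ k l) := mxblockK (fun i j : 'I_m => ((Acoef j i)%:M : 'M[K]_p)^T) i j.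
by rewrite mxE => ->; rewrite !mxE rmorphMn eq_sym.
Qed.

Lemma conj_half_i : ('i / 2%:R : K)^* = - ('i / 2%:R).
Proof. by rewrite rmorphM /= fmorphV rmorph_nat conjCi mulNr. Qed.

(** In block (i, j) the two diagonal coefficients i/2 and -i/2 leave i times s_ij, and the other
    terms involve blocks with a smaller i + j; hence the induction on i + j. *)
Lemma Sylvester_inj m (S : 'M[K]_(\sum_(i < m) p)) :
  Ablock K p m *m S = S *m (Ablock K p m) ^t* -> S = 0.
Proof.
rewrite trmxC_AblockE AblockE -[S]submxblockK; set s := submxblock S.
rewrite !mul_mxblock => /eq_mxblockP E; rewrite -[RHS]mxblock0.
apply/eq_mxblockP => i j; move: {2}(i + j).+1 (ltnSn (i + j)) => k.
elim: k i j => // k IH i j; rewrite ltnS => ijk.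
have := E i j; rewrite (bigD1 i) //= [RHS](bigD1 j) //= !big1 => [|l lj|l li].
- rewrite !addr0 /Acoef !eqxx mul_scalar_mx mul_mx_scalar conj_half_i scaleNr => /eqP.
  rewrite -addr_eq0 -scalerDl -splitr scaler_eq0 (negbTE (neq0Ci K)).
  by move=> /eqP.
- rewrite mul_mx_scalar /Acoef eq_sym (negbTE (lj : val l != val j)).
  case: ltnP => lj'; last by rewrite rmorph0 scale0r.
  by rewrite IH ?scaler0// (leq_trans _ ijk)// ltn_add2l.
- rewrite mul_scalar_mx /Acoef eq_sym (negbTE (li : val l != val i)).
  case: ltnP => li'; last by rewrite scale0r.
  by rewrite IH ?scaler0// (leq_trans _ ijk)// ltn_add2r.
Qed.

(** An injective linear endomorphism of a finite-dimensional space is onto; L is its matrix in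
    [mxvec] coordinates. *)
Lemma Sylvester_surj m (B : 'M[K]_(\sum_(i < m) p)) :
  exists S, Ablock K p m *m S - S *m (Ablock K p m) ^t* = B.
Proof.
set A := Ablock K p m; pose L := lin_mulmx A - lin_mulmxr (A ^t*).
have LE S : mxvec S *m L = mxvec (A *m S - S *m A ^t*).
  by rewrite mulmxBr !mul_vec_lin /= linearB.
have Lu : L \in unitmx.
  rewrite -row_free_unit; apply: inj_row_free => v.
  rewrite -[v]vec_mxK LE => /(canRL mxvecK); rewrite linear0 => /eqP.
  by rewrite subr_eq0 => /eqP /Sylvester_inj ->; rewrite linear0.
exists (vec_mx (mxvec B *m invmx L)); apply: (can_inj mxvecK).
by rewrite -LE vec_mxK mulmxKV.
Qed.

Lemma submxrow_mul_Ablock m r (Y : 'M[K]_(r, \sum_(i < m) p)) l :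
  submxrow (Y *m Ablock K p m) l = ('i / 2%:R) *: submxrow Y l +
    'i *: \sum_(k < m | (l < k)%N) submxrow Y k.
Proof.
rewrite -{1}[Y]submxrowK AblockE mul_mxrow_mxblock mxrowK (bigD1 l) //=.
rewrite /Acoef eqxx mul_mx_scalar scaler_sumr; congr (_ + _).
rewrite big_mkcond [RHS]big_mkcond; apply: eq_bigr => k _.
rewrite mul_mx_scalar; case: eqVneq => [->|kl]; first by rewrite ltnn.
by rewrite (negbTE (kl : val k != val l)); case: ltnP; rewrite ?scale0r.
Qed.

Lemma submxrow_scale m r (c : K) (Y : 'M[K]_(r, \sum_(i < m) p)) l :
  submxrow (c *: Y) l = c *: submxrow Y l.
Proof. by apply/matrixP => a b; rewrite !mxE. Qed.

(** The matrix is block lower triangular with diagonal i, so a row in its left kernel vanishes block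
    by block, starting from the last one. *)
Lemma Ablock_shift_unit m : Ablock K p m + ('i / 2%:R)%:M \in unitmx.
Proof.
rewrite -row_free_unit -kermx_eq0; apply/eqP.
move: (kermx _) (mulmx_ker (Ablock K p m + ('i / 2%:R)%:M)) => Y.
rewrite mulmxDr mul_mx_scalar => E.
rewrite -[Y]submxrowK -[RHS]mxrow0; apply/eq_mxrowP => j.
move: {2}(m - j).+1 (ltnSn (m - j)) => k.
elim: k j => // k IH j; rewrite ltnS => jk.
have /(congr1 (fun Z => submxrow Z j)) := E.
have S0 : \sum_(k < m | (j < k)%N) submxrow Y k = 0.
  by apply: big1 => l jl; rewrite IH// (leq_trans _ jk)// ltn_sub2l.
rewrite submxrow0 submxrowD submxrow_mul_Ablock submxrow_scale S0.
rewrite scaler0 addr0 -scalerDl -splitr => /eqP; rewrite scaler_eq0.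
by rewrite (negbTE (neq0Ci K)) => /eqP.
Qed.

(** The hockey-stick identity: the strictly lower triangular all-ones matrix raises the lower index
    of a column of binomials. *)
Lemma sum_bin_lt m k j : (k <= m)%N ->
  (\sum_(l < m | (l < k)%N) 'C(l, j) = 'C(k, j.+1))%N.
Proof.
move=> km; rewrite -(big_ord_widen _ (fun l => 'C(l, j)) km).
elim: k {km} => [|k IH]; first by rewrite big_ord0.
by rewrite big_ord_recr /= IH binS.
Qed.

(** Controllability of A and Phi_1: the iterates of Phi_1 under the nilpotent part of A span the
    whole space, so only 0 annihilates all of them. [inv] stands for any class of rows stable under
    that nilpotent part. *)
Lemma invariant_ones_ker m r (inv : 'M[K]_(r, \sum_(i < m) p) -> Prop) :
  (forall Y, inv Y -> Y *m block_ones K p m = 0) ->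
  (forall Y, inv Y -> inv (Y *m (Ablock K p m - ('i / 2%:R)%:M))) ->
  forall Y, inv Y -> Y = 0.
Proof.
move=> inv1 invA.
have blk Y l : submxrow (Y *m (Ablock K p m - ('i / 2%:R)%:M)) l =
    \sum_(k < m | (l < k)%N) 'i *: submxrow Y k.
  by rewrite mulmxBr mul_mx_scalar submxrowB submxrow_mul_Ablock submxrow_scale
    addrC addKr scaler_sumr.
(* The j-th power of the nilpotent part of A sends block_ones to 'i ^+ j times the
   column of binomials 'C(k, j). *)
have key j Y : inv Y -> \sum_(k < m) submxrow Y k *+ 'C(k, j) = 0.
  elim: j Y => [|j IH] Y YI.
    have := inv1 _ YI; rewrite -{1}[Y]submxrowK mul_mxrow_mxcol => E.
    by rewrite -[RHS]E; apply: eq_bigr => k _; rewrite bin0 mulmx1.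
  apply: (scalerI (neq0Ci K)); rewrite scaler0 -[RHS](IH _ (invA _ YI)).
  rewrite scaler_sumr; under [RHS]eq_bigr do rewrite blk -sumrMnl.
  rewrite [RHS](exchange_big_dep xpredT) //=; apply: eq_bigr => k _.
  by rewrite sumrMnr (sum_bin_lt _ (ltnW (ltn_ord k))) scalerMnr.
move=> Y YI; rewrite -[Y]submxrowK -[RHS]mxrow0; apply/eq_mxrowP => j.
(* The relations [key j] form a unitriangular system, since 'C(k, j) vanishes for k < j; it is
   solved from the last block backwards. *)
move: {2}(m - j).+1 (ltnSn (m - j)) => k.
elim: k j => // k IH j; rewrite ltnS => jk.
have := key j Y YI; rewrite (bigD1 j) //= binn big1 ?addr0// => i ij.
case: (ltngtP i j) => [lij|lji|/val_inj e]; last by rewrite e eqxx in ij.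
  by rewrite bin_small.
rewrite IH ?mul0rn// (leq_trans _ jk)// ltn_sub2l//.
Qed.

(** Taking adjoints, uniqueness makes S self-adjoint. If Y S = 0, the identity multiplied by Y and
    its adjoint gives Y Pi = 0; multiplied by Y alone it then gives Y A S = 0, so the left kernel is
    stable under A and annihilates Phi_1. *)
Lemma S_identity_unit n (a : nat -> 'M[K]_p) (S : 'M[K]_(\sum_(i < n.+1) p)) :
  S_identity a S -> S \in unitmx.
Proof.
rewrite /S_identity; set A := Ablock K p n.+1; set P := Pi n a => SI.
have SH : S ^t* = S.
  apply/eqP; rewrite -subr_eq0; apply/eqP/Sylvester_inj.
  have : A *m S ^t* - S ^t* *m A ^t* = A *m S - S *m A ^t*.
    have := congr1 (fun X => - X ^t*) SI; rewrite trmxCB trmxCZ !trmxC_mul !trmxCK.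
    by rewrite conjCi scaleNr opprK opprB SI.
  move=> /eqP; rewrite subr_eq => /eqP E; rewrite mulmxBr mulmxBl E.
  by rewrite addrAC [_ - _ - A *m S]addrAC subrr add0r addrC.
have PiY r (Y : 'M[K]_(r, \sum_(i < n.+1) p)) : Y *m S = 0 -> Y *m P = 0.
  move=> YS; apply: mulmx_trmxC_eq0; apply: (scalerI (neq0Ci K)).
  rewrite scaler0 trmxC_mul mulmxA -[Y *m P *m _]mulmxA scalemxAl scalemxAr -SI.
  have SY : S *m Y ^t* = 0 by rewrite -{1}SH -trmxC_mul YS trmx0 map_mx0.
  by rewrite mulmxBr (mulmxA Y S) YS mul0mx subr0 -!mulmxA SY !mulmx0.
rewrite -row_free_unit -kermx_eq0; apply/eqP.
apply: (@invariant_ones_ker _ _ (fun Y => Y *m S = 0)) (mulmx_ker _) => Y YS.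
  have := PiY _ _ YS; rewrite /P /Pi mul_mx_row => /(congr1 lsubmx).
  by rewrite row_mxKl linear0.
rewrite mulmxBr mul_mx_scalar mulmxBl -scalemxAl YS scaler0 subr0.
have /eqP := congr1 (mulmx Y) SI.
rewrite mulmxBr -scalemxAr (mulmxA Y P) PiY// mul0mx scaler0 !mulmxA YS mul0mx subr0.
by move/eqP.
Qed.

End Sylvester.

(** * Weyl functions and matrix products *)

Section Transfer.
Variables (K : numClosedFieldType) (p : nat).
Implicit Types (C : nat -> 'M[K]_(p + p)).

(** Clearing the pole at l = 0 turns W_k and its adjoint into these polynomials. The factors have
    the shape l + B expected by [analytic_mx_affine]. *)
Fixpoint left_prod C (k : nat) (l : K) : 'M[K]_(p + p) :=
  if k is k'.+1 then (l *: 1%:M + - 'i *: C k') *m left_prod C k' l else 1%:M.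

Fixpoint right_prod C (k : nat) (l : K) : 'M[K]_(p + p) :=
  if k is k'.+1 then right_prod C k' l *m (l *: 1%:M + 'i *: C k') else 1%:M.

Lemma Wsol_left_prod C k l : l != 0 -> l ^+ k *: Wsol C k l = left_prod C k l.
Proof.
move=> l0; elim: k => [|k IH] /=; first by rewrite expr0 scale1r.
rewrite -IH mulmxDl -!scalemxAl mul1mx -!scalemxAr scalerBr scalerA -exprS.
rewrite scaleNr !scalerA; congr (_ - _ *: _).
by rewrite exprS; field.
Qed.

Lemma left_prod_trmxC C k l : (forall j, (j < k)%N -> (C j) ^t* = C j) ->
  (left_prod C k l^*) ^t* = right_prod C k l.
Proof.
elim: k => [|k IH] CH /=; first exact: trmxC1.
rewrite trmxC_mul IH => [|j jk]; last by rewrite CH// ltnW.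
by rewrite trmxCD !trmxCZ trmxC1 conjCK rmorphN /= conjCi opprK CH.
Qed.

Lemma calW_right_prod n C l : (forall k, (k <= n)%N -> (C k) ^t* = C k) ->
  l != 0 -> l ^+ n.+1 *: calW n C l = right_prod C n.+1 l.
Proof.
move=> CH l0; rewrite -left_prod_trmxC; last by move=> j; exact: CH.
rewrite -Wsol_left_prod ?conjC_eq0// trmxCZ rmorphXn /= conjCK.
by [].
Qed.

Lemma involution_factor m (M : 'M[K]_m) (a l : K) : M *m M = 1%:M ->
  (l *: 1%:M + a *: M) *m (l *: 1%:M - a *: M) = ((l - a) * (l + a)) *: 1%:M.
Proof.
move=> MM; rewrite !mulmxDl !mulmxBr -!scalemxAl -!scalemxAr !mul1mx !mulmx1 MM.
by apply/matrixP => i j; rewrite !mxE; ring.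
Qed.

Lemma left_right_prod C k l : (forall j, (j < k)%N -> C j *m C j = 1%:M) ->
  left_prod C k l *m right_prod C k l = ((l - 'i) * (l + 'i)) ^+ k *: 1%:M.
Proof.
elim: k => [|k IH] CC /=; first by rewrite expr0 scale1r mulmx1.
rewrite mulmxA -[_ *m left_prod _ _ _ *m _]mulmxA IH; last by move=> j jk; rewrite CC// ltnW.
have := involution_factor (- 'i) l (CC k (ltnSn k)).
rewrite -scalemxAr mulmx1 -scalemxAl !scaleNr !opprK => ->.
by rewrite scalerA exprSr [(l + _) * _]mulrC.
Qed.

Lemma right_left_prod C k l : (forall j, (j < k)%N -> C j *m C j = 1%:M) ->
  right_prod C k l *m left_prod C k l = ((l - 'i) * (l + 'i)) ^+ k *: 1%:M.
Proof.
elim: k => [|k IH] CC /=; first by rewrite expr0 scale1r mulmx1.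
have := involution_factor 'i l (CC k (ltnSn k)).
rewrite mulmxA -(mulmxA (right_prod C k l)) scaleNr => ->.
rewrite -scalemxAr mulmx1 -scalemxAl IH ?scalerA ?exprS// => j jk.
by rewrite CC// ltnW.
Qed.

Lemma analytic_left_prod C k q (Y : K -> 'M[K]_(p + p, q)) z0 :
  analytic_mx Y z0 -> analytic_mx (fun l => left_prod C k l *m Y l) z0.
Proof.
move=> Ya; elim: k => [|k IH] /=.
  by apply: analytic_mx_ext Ya => l; rewrite mul1mx.
apply: analytic_mx_ext (analytic_mx_affine 1%:M (- 'i *: C k) IH) => l.
by rewrite mulmxA.
Qed.

Lemma analytic_right_prod C k q (Y : K -> 'M[K]_(p + p, q)) z0 :
  analytic_mx Y z0 -> analytic_mx (fun l => right_prod C k l *m Y l) z0.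
Proof.
elim: k Y => [|k IH] Y Ya /=.
  by apply: analytic_mx_ext Ya => l; rewrite mul1mx.
apply: analytic_mx_ext (IH _ (analytic_mx_affine 1%:M ('i *: C k) Ya)) => l.
by rewrite mulmxA.
Qed.

Lemma analytic_usubmx m1 m2 q (f : K -> 'M[K]_(m1 + m2, q)) z0 :
  analytic_mx f z0 -> analytic_mx (fun z => usubmx (f z)) z0.
Proof.
move=> /(analytic_mx_mulr (row_mx 1%:M 0)); apply: analytic_mx_ext => z.
rewrite -{1}[f z]vsubmxK mul_row_col mul1mx mul0mx addr0.
by [].
Qed.

Lemma analytic_dsubmx m1 m2 q (f : K -> 'M[K]_(m1 + m2, q)) z0 :
  analytic_mx f z0 -> analytic_mx (fun z => dsubmx (f z)) z0.
Proof.
move=> /(analytic_mx_mulr (row_mx 0 1%:M)); apply: analytic_mx_ext => z.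
rewrite -{1}[f z]vsubmxK mul_row_col mul1mx mul0mx add0r.
by [].
Qed.

Lemma analytic_col_mx m1 m2 q (f : K -> 'M[K]_(m1, q)) (g : K -> 'M[K]_(m2, q)) z0 :
  analytic_mx f z0 -> analytic_mx g z0 -> analytic_mx (fun z => col_mx (f z) (g z)) z0.
Proof.
move=> /(analytic_mx_mulr (col_mx 1%:M (0 : 'M[K]_(m2, m1)))) fa.
move=> /(analytic_mx_mulr (col_mx (0 : 'M[K]_(m1, m2)) 1%:M)) ga.
apply: analytic_mx_ext (analytic_mxD fa ga) => z.
by rewrite !mul_col_mx !mul1mx !mul0mx add_col_mx add0r addr0.
Qed.

Lemma near_i_neq (a : K) : a != 'i -> \forall l \near 'i, l != a.
Proof.
rewrite eq_sym -subr_eq0 -normr_gt0 => ia; near=> l.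
have : `|l - 'i| <= `|'i - a| / 2 by near: l; apply: near_dist_le; rewrite divr_gt0.
apply: contraTneq => ->; rewrite distrC lt_geF//.
by rewrite ltr_pdivrMr// ltr_pMr// ltr1n.
Unshelve. all: end_near. Qed.

Lemma weyl_numE n C (Y : K -> 'M[K]_(p + p, p)) l :
  weyl_num n C (fun l => usubmx (Y l)) (fun l => dsubmx (Y l)) l =
  usubmx (calW n C l *m Y l).
Proof.
rewrite /weyl_num -{3}[Y l]vsubmxK -{3}[calW n C l]submxK mul_block_col.
by rewrite col_mxKu.
Qed.

Lemma weyl_denomE n C (Y : K -> 'M[K]_(p + p, p)) l :
  weyl_denom n C (fun l => usubmx (Y l)) (fun l => dsubmx (Y l)) l =
  dsubmx (calW n C l *m Y l).
Proof.
rewrite /weyl_denom -{3}[Y l]vsubmxK -{3}[calW n C l]submxK mul_block_col.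
by rewrite col_mxKd.
Qed.

(** Stack R and Q into Y. The scalar l^(n+1) cancels in the quotient, and since the denominator
    stays invertible near i, the fraction amounts to proportionality with [phi; 1]. *)
Lemma weyl_functionP n C (phi : K -> 'M[K]_p) :
  (forall k, (k <= n)%N -> (C k) ^t* = C k) ->
  weyl_function n C phi <->
  exists Y : K -> 'M[K]_(p + p, p), [/\ analytic_mx Y 'i,
    dsubmx (right_prod C n.+1 'i *m Y 'i) \in unitmx &
    \forall l \near 'i, right_prod C n.+1 l *m Y l =
      col_mx (phi l) 1%:M *m dsubmx (right_prod C n.+1 l *m Y l)].
Proof.
move=> CH; have i0 := neq0Ci K.
have unitE (Y : K -> 'M[K]_(p + p, p)) l : l != 0 ->
    (dsubmx (calW n C l *m Y l) \in unitmx) =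
    (dsubmx (right_prod C n.+1 l *m Y l) \in unitmx).
  move=> l0; rewrite -calW_right_prod// -scalemxAl linearZ /=.
  by rewrite unitmxZ// unitfE expf_neq0.
split.
  move=> [r [q [[ra qa Du] phiE]]].
  pose Y l := col_mx (r l) (q l).
  have Ya : analytic_mx Y 'i := analytic_col_mx ra qa.
  have rE : r = fun l => usubmx (Y l) by apply/funext => l; rewrite col_mxKu.
  have qE : q = fun l => dsubmx (Y l) by apply/funext => l; rewrite col_mxKd.
  move: Du phiE; rewrite rE qE weyl_denomE -[_ != 0]unitfE -unitmxE unitE// => Du phiE.
  exists Y; split => //.
  have Dn := near_unitmx (analytic_dsubmx (analytic_right_prod C n.+1 Ya)) Du.
  near=> l; have l0 : l != 0 by near: l; apply: near_i_neq; rewrite eq_sym.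
  have -> : phi l = weyl_num n C (fun l => usubmx (Y l)) (fun l => dsubmx (Y l)) l *m
    invmx (weyl_denom n C (fun l => usubmx (Y l)) (fun l => dsubmx (Y l)) l) by near: l.
  rewrite weyl_numE weyl_denomE mul_col_mx mul1mx.
  have Dl : dsubmx (right_prod C n.+1 l *m Y l) \in unitmx by near: l.
  rewrite -calW_right_prod// -!scalemxAl !linearZ /= -?scalemxAr mulmxKV ?unitE//.
  by rewrite -scale_col_mx vsubmxK.
move=> [Y [Ya Du YE]]; exists (fun l => usubmx (Y l)), (fun l => dsubmx (Y l)); split.
  split; [exact: analytic_usubmx|exact: analytic_dsubmx|].
  by rewrite weyl_denomE -[_ != 0]unitfE -unitmxE unitE.
have Dn := near_unitmx (analytic_dsubmx (analytic_right_prod C n.+1 Ya)) Du.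
near=> l; have l0 : l != 0 by near: l; apply: near_i_neq; rewrite eq_sym.
have Dl : dsubmx (right_prod C n.+1 l *m Y l) \in unitmx by near: l.
rewrite weyl_numE weyl_denomE.
have E : right_prod C n.+1 l *m Y l =
  col_mx (phi l) 1%:M *m dsubmx (right_prod C n.+1 l *m Y l) by near: l.
have {}E : calW n C l *m Y l = col_mx (phi l) 1%:M *m dsubmx (calW n C l *m Y l).
  apply: (scalerI (expf_neq0 n.+1 l0)).
  by rewrite scalemxAl scalemxAr -linearZ /= scalemxAl calW_right_prod.
by rewrite {1}E mul_col_mx col_mxKu mulmxK ?unitE.
Unshelve. all: end_near. Qed.

End Transfer.

(** * The matrices V_- and the interpolation identity *)

Section VBlocks.
Variables (K : numClosedFieldType) (p : nat) (beta : nat -> 'M[K]_(p, p + p)).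

(* The last clause is block (k, j) of L V = V N, where L is the strictly lower
   triangular part of (beta k *m (beta j)^t* )_(k, j) and N the strictly lower
   triangular matrix of identity blocks. *)
Definition block_relations m (v : nat -> nat -> 'M[K]_p) :=
  forall k, (k <= m)%N ->
  [/\ forall j, (k < j)%N -> v k j = 0,
      v k k = vminus beta k,
      \sum_(j < k.+1) v k j = beta1 beta k &
      forall j, (j < k)%N ->
        \sum_(l < k) beta k *m (beta l) ^t* *m v l j =
        \sum_(l < k.+1 | (j < l)%N) v k l].

(** A(m - 1) + i/2 has i on and below the diagonal, so right multiplication by it gives i times tail
    sums of blocks; this undoes the inverse in [Xtilde]. *)
Lemma Xtilde_relation m (v : nat -> nat -> 'M[K]_p) (j : 'I_m) :
  \sum_(l < m | (j <= l)%N)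
     submxrow (Xtilde beta (\mxblock_(i < m.+1, k < m.+1) v i k)) l + vminus beta m.+1 =
  \sum_(l < m.+1) beta m.+1 *m (beta l) ^t* *m v l j.
Proof.
set V := \mxblock_(i, k) v i k; set X := Xtilde beta V.
have XE : X *m (Ablock K p m + ('i / 2%:R)%:M) =
  'i *: (beta m.+1 *m (\mxrow_(j < m.+1) (beta j) ^t*) *m V
            *m (\mxblock_(i < m.+1, j < m)
                  (if (i == j :> nat) then 1%:M else 0 : 'M[K]_p))
          - vminus beta m.+1 *m (\mxrow_(j < m) (1%:M : 'M[K]_p))).
  by rewrite /X /Xtilde -scalemxAl mulmxKV ?Ablock_shift_unit.
move: (vminus beta m.+1) XE => w XE; clearbody X.
have := congr1 (fun Z => submxrow Z j) XE.
rewrite mulmxDr mul_mx_scalar submxrowD submxrow_mul_Ablock !submxrow_scale submxrowB.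
rewrite addrAC -scalerDl -splitr -scalerDr => /(scalerI (neq0Ci K)).
rewrite mul_mxrow mul_mxrow mxrowK mulmx1 mul_mxrow_mxblock mul_mxrow_mxblock !mxrowK.
rewrite (bigD1 (widen_ord (leqnSn m) j)) //= eqxx mulmx1 [X in _ + X - _]big1 ?addr0 => [E|i].
  rewrite (bigD1 j) //= -[RHS](subrK w) -E; congr (_ + _ + _).
  by apply: eq_bigl => l; rewrite andbC ltn_neqAle eq_sym.
by rewrite -val_eqE /= => /negbTE ->; rewrite mulmx0.
Qed.

(** Replaces the recursion on matrices of growing size by a family of blocks indexed by natural
    numbers. *)
Lemma Vminus_blocks m : exists v : nat -> nat -> 'M[K]_p,
  Vminus beta m = \mxblock_(i < m.+1, j < m.+1) v i j /\ block_relations m v.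
Proof.
elim: m => [|m [v [VE vR]]].
  exists (fun k j => if (k == 0%N) && (j == 0%N) then vminus beta 0 else 0); split.
    by apply/eq_mxblockP => i j; rewrite !ord1.
  move=> k; rewrite leqn0 => /eqP ->; split => //; first by case.
  by rewrite big_ord1.
set V := Vminus beta m in VE *; set X := Xtilde beta V.
(* The new block row is X0, then Xtilde, then [vminus]; the default 0 of [xt] provides the zeros
   above the diagonal. *)
pose xt j := if insub j is Some j' then submxrow X (j' : 'I_m) else 0 : 'M[K]_p.
pose row j := if j == m.+1 then vminus beta m.+1 else
  if j is j'.+1 then xt j' else X0 beta V.
exists (fun k j => if (k <= m)%N then v k j else row j); split.
  rewrite /= -/V; apply/eq_mxblockP => i j.
  case: unliftP => [i' ->|->]; case: unliftP => [j' ->|->].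
  - by rewrite !lift_max -ltnS ltn_ord VE mxblockK.
  - rewrite lift_max -ltnS ltn_ord /=.
    by have [v0 _ _ _] := vR i' (ltn_ord i'); rewrite v0//= ltn_ord.
  - rewrite lift_max ltnn /row ltn_eqF// mxrowK; case: unliftP => [l ->|->] /=.
      rewrite /xt insubT //=; first exact: ltn_ord. move=> H; congr submxrow; exact: val_inj.
    by [].
  - by rewrite ltnn /row eqxx.
move=> k; rewrite leq_eqVlt => /orP [/eqP ->|]; last first.
  rewrite ltnS => km; have [v1 v2 v3 v4] := vR k km; rewrite km; split => //.
  move=> j jk; rewrite -v4//; apply: eq_bigr => l _.
  by rewrite (leq_trans (ltnW (ltn_ord l)) km).
rewrite ltnn; split.
- move=> [|j]//; rewrite ltnS => mj; rewrite /row eqSS gtn_eqF//.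
  by rewrite /xt insubN// -leqNgt ltnW.
- by rewrite /row eqxx.
- rewrite big_ord_recr big_ord_recl /= {1}/row /= /row eqxx.
  rewrite [X in _ + X + _](_ : _ = Xtilde beta V *m block_ones K p m); first last.
    rewrite -[Xtilde beta V]submxrowK /block_ones mul_mxrow_mxcol.
    apply: eq_bigr => l _; rewrite mulmx1 /bump /= add1n eqSS ltn_eqF ?ltn_ord//.
    rewrite /xt ?add0n (insubT (fun k => k < m)%N (ltn_ord l)) /=.
    by congr submxrow; apply: val_inj.
  by rewrite /X0 subrK addrC addrC subrK.
(* For j = m each sum reduces to its last term and the relation is the recursion of [vminus]; for j
   < m it is [Xtilde_relation]. *)
move=> j; rewrite ltnS leq_eqVlt => /orP [/eqP ->|jm].
  rewrite (bigD1 ord_max) //= leqnn big1 ?addr0; last first.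
    move=> l lm; have lm' : (l < m)%N by rewrite ltn_neqAle -ltnS ltn_ord andbT.
    by rewrite ltnW//; have [v0 _ _ _] := vR l (ltnW lm'); rewrite v0// mulmx0.
  rewrite (bigD1 ord_max) //= big1 ?addr0 => [|l /andP [ml lm]]; last first.
    by move: lm; rewrite -val_eqE /= neq_ltn ltnNge ml ltnNge -ltnS ltn_ord.
  by rewrite /row eqxx; have [_ -> _ _] := vR m (leqnn m).
rewrite (eq_bigr (fun l : 'I_m.+1 => beta m.+1 *m (beta l) ^t* *m v l j)); last first.
  by move=> l _; rewrite -ltnS ltn_ord.
have := Xtilde_relation v (Ordinal jm); rewrite -VE /= => <-.
rewrite [RHS]big_mkcond big_ord_recl big_ord_recr /= add0r /bump /= !add1n ltnS (ltnW jm).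
rewrite /row eqxx; congr (_ + _); rewrite [LHS]big_mkcond; apply: eq_bigr => l _.
rewrite !add1n ltnS eqSS ltn_eqF//; case: leqP => // _.
by rewrite /xt ?add0n (insubT (fun k => k < m)%N (ltn_ord l)) /=; congr submxrow; apply: val_inj.
Qed.

Lemma Vminus_unit m : (forall k, (k <= m)%N -> vminus beta k \in unitmx) ->
  Vminus beta m \in unitmx.
Proof.
move=> vu; have [v [-> vR]] := Vminus_blocks m; set V := \mxblock_(i, j) _.
rewrite -row_full_unit -cokermx_eq0; apply/eqP.
move: (cokermx V) (mulmx_coker V) => Z; rewrite -{1}[Z]submxcolK mul_mxblock_mxrow.
move=> /eqP; rewrite -[X in _ == X]mxcol0 => /eqP /eq_mxcolP E; rewrite -[Z]submxcolK -[RHS]mxcol0.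
apply/eq_mxcolP => i; move: {2}i.+1 (ltnSn i) => k.
elim: k i => // k IH i; rewrite ltnS => ik.
have [v0 vd _ _] := vR i (ltn_ord i).
have := E i; rewrite [X in X = _](bigD1 i) //= [X in _ + X]big1 => [|j ji]; last first.
  case: (ltngtP j i) => [lji|lij|/val_inj e]; last by rewrite e eqxx in ji.
    by rewrite IH ?mulmx0// (leq_trans lji).
  by rewrite v0 ?mul0mx.
rewrite addr0 vd => /(congr1 (mulmx (invmx (vminus beta i)))).
by rewrite mulmx0 mulKmx// vu// -ltnS ltn_ord.
Qed.

Lemma psi_relation m (v : nat -> nat -> 'M[K]_p) :
  Vminus beta m = \mxblock_(i < m.+1, j < m.+1) v i j ->
  block_relations m v -> (forall k, (k <= m)%N -> vminus beta k \in unitmx) ->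
  forall k, (k <= m)%N -> \sum_(j < k.+1) v k j *m psi beta m j = beta2 beta k.
Proof.
move=> VE vR vu k km; have Vu := Vminus_unit vu.
pose B := \mxcol_(j < m.+1) beta2 beta j; pose X := invmx (Vminus beta m) *m B.
have : Vminus beta m *m X = B by rewrite mulKVmx.
rewrite -[X]submxcolK VE mul_mxblock_mxrow.
move=> /(congr1 (fun Z => submxcol Z (inord k))); rewrite !mxcolK.
have [v0 _ _ _] := vR k km.
rewrite inordK ?ltnS// => <-.
rewrite (big_ord_widen m.+1 (fun j => v k j *m psi beta m j))// big_mkcond.
apply: eq_bigr => j _; rewrite /psi inord_val -/B -/X; case: ltnP => // jk.
by rewrite v0// mul0mx.
Qed.


(** * The polynomial interpolant *)

Section Interpolation.
Variables (n : nat) (v : nat -> nat -> 'M[K]_p) (c : nat -> 'M[K]_p).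
Hypothesis vR : block_relations n v.
Hypothesis psiR : forall k, (k <= n)%N -> \sum_(j < k.+1) v k j *m c j = beta2 beta k.
Hypothesis betaU : forall k, (k <= n)%N -> beta k *m (beta k) ^t* = 1%:M.

Definition psi_poly (z : K) : 'M[K]_p :=
  - c 0 + \sum_(1 <= k < n.+1) z ^+ k *: (c k.-1 - c k).

Definition psi_tail k (z : K) : 'M[K]_p :=
  \sum_(k <= j < n) z ^+ (j - k) *: (c j - c j.+1).

(* V_tail k z is beta k *m interpolant k z divided by z, see beta_interpolant;
   psi_tail solves the same system after conjugation by V_-. *)
Definition V_tail k (z : K) := \sum_(j < n.+1) v k j *m psi_tail j z.

(** What is left of [psi_poly; 1] after the first k factors (l + i C_j) / (l + i) have been stripped
    off; it stays polynomial in z. *)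
Definition interpolant k (z : K) : 'M[K]_(p + p, p) :=
  col_mx (psi_poly z) 1%:M +
  (1 - z) *: \sum_(j < k) (beta j) ^t* *m V_tail j z.

Lemma psi_poly_tail z : psi_poly z = - c 0 + z *: psi_tail 0 z.
Proof.
congr (_ + _); rewrite big_add1 /= /psi_tail scaler_sumr; apply: eq_bigr => j _.
by rewrite scalerA subn0 exprS.
Qed.

Lemma psi_tail_rec k z : (k < n)%N ->
  psi_tail k z = c k - c k.+1 + z *: psi_tail k.+1 z.
Proof.
move=> kn; rewrite /psi_tail big_ltn// subnn expr0 scale1r; congr (_ + _).
rewrite scaler_sumr; apply: eq_big_nat => j /andP [kj _].
by rewrite scalerA -exprS -subSn.
Qed.

(** Row l of (z - (1 - z) N) t = Phi_1 psi_poly + c, with t the column of the [psi_tail] and N the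
    strictly lower triangular matrix of identity blocks. *)
Lemma psi_tail_sum l z : (l <= n)%N ->
  z *: psi_tail l z - (1 - z) *: \sum_(j < l) psi_tail j z = psi_poly z + c l.
Proof.
elim: l => [|l IH] ln.
  by rewrite big_ord0 scaler0 subr0 psi_poly_tail addrAC addNr add0r.
have := IH (ltnW ln); rewrite big_ord_recr /= (psi_tail_rec _ ln).
set s := \sum_(j < l) _; set t := psi_tail l.+1 z => E.
have -> : psi_poly z = z *: (c l - c l.+1 + z *: t) - (1 - z) *: s - c l.
  by rewrite E addrK.
by apply/matrixP => a b; rewrite !mxE; ring.
Qed.

(** This is [psi_tail_sum] multiplied on the left by V_-: the intertwining replaces N by the
    strictly lower part of the Gram matrix, and V_- sends Phi_1 and c to the columns of beta_1 and
    beta_2. *)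
Lemma V_tail_relation k z : (k <= n)%N ->
  z *: V_tail k z - (1 - z) *: \sum_(l < k) beta k *m (beta l) ^t* *m V_tail l z =
  beta1 beta k *m psi_poly z + beta2 beta k.
Proof.
move=> kn; have [v0 _ v1 vb] := vR kn; rewrite -v1 -psiR// mulmx_suml -big_split /=.
have trunc (F : nat -> 'M[K]_p) : \sum_(j < n.+1) v k j *m F j = \sum_(j < k.+1) v k j *m F j.
  rewrite [RHS](big_ord_widen n.+1 (fun j => v k j *m F j))// [RHS]big_mkcond.
  by apply: eq_bigr => j _; case: ltnP => // jk; rewrite v0// mul0mx.
rewrite {1}/V_tail (trunc (psi_tail^~ z)).
have -> : \sum_(l < k) beta k *m (beta l) ^t* *m V_tail l z =
    \sum_(l < k.+1) v k l *m \sum_(j < l) psi_tail j z.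
  rewrite /V_tail; under eq_bigr do rewrite mulmx_sumr.
  rewrite exchange_big /=.
  under eq_bigr do (under eq_bigr do rewrite mulmxA; rewrite -mulmx_suml).
  transitivity (\sum_(j < n.+1) (if (j < k)%N then
      \sum_(l < k.+1 | (j < l)%N) v k l else 0) *m psi_tail j z).
    apply: eq_bigr => j _; case: ltnP => jk; first by rewrite vb.
    rewrite mul0mx big1 ?mul0mx// => l _.
    have [v0' _ _ _] := vR (leq_trans (ltnW (ltn_ord l)) kn).
    by rewrite v0' ?mulmx0// (leq_trans (ltn_ord l)).
  rewrite (eq_bigr (fun j : 'I_n.+1 => \sum_(l < k.+1 | (j < l)%N) v k l *m psi_tail j z)).
    rewrite (exchange_big_dep xpredT) //=; apply: eq_bigr => l _.
    rewrite mulmx_sumr [RHS](big_ord_widen n.+1 (fun j => v k l *m psi_tail j z))//.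
    by rewrite (leq_trans (ltnW (ltn_ord l))).
  move=> j _; case: ltnP => jk; first by rewrite mulmx_suml.
  rewrite mul0mx big1// => l jl.
  by have := ltn_ord l; rewrite ltnS leqNgt (leq_ltn_trans jk jl).
rewrite !scaler_sumr -sumrB; apply: eq_bigr => l _.
rewrite !scalemxAr -mulmxBr psi_tail_sum ?mulmxDr//.
by rewrite (leq_trans _ kn)// -ltnS ltn_ord.
Qed.

Lemma beta_interpolant k z : (k <= n)%N -> beta k *m interpolant k z = z *: V_tail k z.
Proof.
move=> kn; rewrite /interpolant mulmxDr -scalemxAr mulmx_sumr.
under eq_bigr do rewrite mulmxA.
rewrite -[beta k in X in X + _]hsubmxK mul_row_col mulmx1.
by rewrite -/(beta1 beta k) -/(beta2 beta k) -V_tail_relation// subrK.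
Qed.

(** Here l + i C_k = (l + i) - 2i P_k and beta(k) maps the new interpolant to [V_tail k z]; the
    increment then cancels because (l + i)(1 - z) = 2i. *)
Lemma interpolant_step (C : nat -> 'M[K]_(p + p)) k l : (k <= n)%N ->
  C k = 1%:M - 2%:R *: ((beta k) ^t* *m beta k) -> l + 'i != 0 ->
  let z := (l - 'i) / (l + 'i) in
  (l *: 1%:M + 'i *: C k) *m interpolant k.+1 z = (l + 'i) *: interpolant k z.
Proof.
move=> kn CE li z.
have hE : interpolant k.+1 z = interpolant k z + (1 - z) *: ((beta k) ^t* *m V_tail k z).
  by rewrite /interpolant big_ord_recr /= scalerDr addrA.
have -> : l *: 1%:M + 'i *: C k = (l + 'i) *: 1%:M - (2%:R * 'i) *: ((beta k) ^t* *m beta k).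
  by rewrite CE; apply/matrixP => a b; rewrite !mxE; ring.
have bh : beta k *m interpolant k.+1 z = V_tail k z.
  rewrite hE mulmxDr beta_interpolant// -scalemxAr mulmxA betaU// mul1mx -scalerDl.
  by rewrite addrC subrK scale1r.
rewrite mulmxBl -!scalemxAl mul1mx -mulmxA bh hE scalerDr -addrA -[RHS]addr0; congr (_ + _).
rewrite scalerA -scalerBl; apply/eqP; rewrite scaler_eq0; apply/orP; left.
by apply/eqP; rewrite /z; field.
Qed.

Lemma right_prod_interpolant (C : nat -> 'M[K]_(p + p)) l :
  (forall k, (k <= n)%N -> C k = 1%:M - 2%:R *: ((beta k) ^t* *m beta k)) ->
  l + 'i != 0 -> let z := (l - 'i) / (l + 'i) in
  right_prod C n.+1 l *m interpolant n.+1 z =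
  (l + 'i) ^+ n.+1 *: col_mx (psi_poly z) 1%:M.
Proof.
move=> CE li z.
have : (n.+1 <= n.+1)%N by []; move: {1 3 4 5}n.+1 => k.
elim: k => [|k IH] kn.
  by rewrite /= mul1mx expr0 scale1r /interpolant big_ord0 scaler0 addr0.
rewrite /= -mulmxA interpolant_step// ?CE//.
by rewrite -scalemxAr IH ?(ltnW kn)// scalerA exprS.
Qed.

Lemma analytic_exprZ k m q (A : 'M[K]_(m, q)) z0 : analytic_mx (fun z => z ^+ k *: A) z0.
Proof.
elim: k => [|k IH].
  by apply: analytic_mx_ext (analytic_mx_cst A z0) => z; rewrite expr0 scale1r.
apply: analytic_mx_ext (analytic_mx_affine 1%:M 0 IH) => z.
by rewrite addr0 -scalemxAl mul1mx scalerA exprS.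
Qed.

Lemma analytic_interpolant k z0 : analytic_mx (interpolant k) z0.
Proof.
have ta j : analytic_mx (psi_tail j) z0.
  apply: (@analytic_mx_sum _ _ _ _ _ (fun j z => _)) => i; exact: analytic_exprZ.
have pa : analytic_mx psi_poly z0.
  apply: analytic_mxD; first exact: analytic_mx_cst.
  apply: (@analytic_mx_sum _ _ _ _ _ (fun j z => _)) => i; exact: analytic_exprZ.
apply: analytic_mxD.
  apply: analytic_col_mx => //; exact: analytic_mx_cst.
have Va j : analytic_mx (V_tail j) z0.
  by apply: (@analytic_mx_sum _ _ _ _ _ (fun j z => _)) => i; exact: analytic_mx_mulr.
have Sa : analytic_mx (fun z => \sum_(j < k) (beta j) ^t* *m V_tail j z) z0.
  by apply: (@analytic_mx_sum _ _ _ _ _ (fun j z => _)) => i; exact: analytic_mx_mulr.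
apply: analytic_mx_ext (analytic_mx_affine (- 1%:M) 1%:M Sa) => z.
by rewrite mulmxDl scalerN mulNmx -scalemxAl !mul1mx addrC scalerBl scale1r.
Qed.

End Interpolation.
End VBlocks.

(** * Existence of a system *)

Section Construction.
Variables (K : numClosedFieldType) (p : nat).

Definition reflection (b : 'M[K]_(p, p + p)) : 'M[K]_(p + p) :=
  1%:M - 2%:R *: (b ^t* *m b).

Lemma reflection_trmxC (b : 'M[K]_(p, p + p)) : (reflection b) ^t* = reflection b.
Proof. by rewrite trmxCB trmxC1 trmxCZ trmxC_mul trmxCK rmorph_nat. Qed.

Lemma reflection_involutive (b : 'M[K]_(p, p + p)) : b *m b ^t* = 1%:M ->
  reflection b *m reflection b = 1%:M.
Proof.
move=> bb; rewrite /reflection !mulmxBl !mulmxBr !mul1mx mulmx1 -scalemxAl -scalemxAr.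
rewrite -mulmxA (mulmxA b) bb mul1mx.
by apply/matrixP => i j; rewrite !mxE; ring.
Qed.

Lemma involution_inv m (M : 'M[K]_m) : M *m M = 1%:M -> M \in unitmx /\ M = invmx M.
Proof.
move=> MM; have [Mu _] := mulmx1_unit MM; split => //.
by rewrite -[RHS]mulmx1 -MM mulKmx.
Qed.

Lemma weyl_of_factorization n (C : nat -> 'M[K]_(p + p)) (phi : K -> 'M[K]_p)
    (Y : K -> 'M[K]_(p + p, p)) :
  (forall k, (k <= n)%N -> (C k) ^t* = C k) -> analytic_mx Y 'i ->
  (\forall l \near 'i, right_prod C n.+1 l *m Y l =
     (l + 'i) ^+ n.+1 *: col_mx (phi l) 1%:M) ->
  weyl_function n C phi.
Proof.
move=> CH Ya YE; apply/weyl_functionP => //; exists Y.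
have dE l : right_prod C n.+1 l *m Y l = (l + 'i) ^+ n.+1 *: col_mx (phi l) 1%:M ->
    dsubmx (right_prod C n.+1 l *m Y l) = (l + 'i) ^+ n.+1 *: 1%:M.
  by move=> ->; rewrite scale_col_mx col_mxKd.
split => //.
  rewrite dE; last exact: nbhs_singleton YE.
  by rewrite unitmxZ ?unitmx1// unitfE expf_neq0// -mulr2n mulrn_eq0 neq0Ci.
near=> l; have E : right_prod C n.+1 l *m Y l = (l + 'i) ^+ n.+1 *: col_mx (phi l) 1%:M.
  by near: l.
by rewrite (dE _ E) E -scalemxAr mulmx1.
Unshelve. all: end_near. Qed.

(** The upper half of the inverse of [E G] annihilates G and is a left inverse of E; Gram-Schmidt
    orthonormalizes its rows without changing their span. *)
Lemma orthonormal_annihilator (E G : 'M[K]_(p + p, p)) : row_mx E G \in unitmx ->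
  exists b : 'M[K]_(p, p + p), [/\ b *m b ^t* = 1%:M, b *m G = 0 & b *m E \in unitmx].
Proof.
move=> Zu; pose U := usubmx (invmx (row_mx E G)).
have : invmx (row_mx E G) *m row_mx E G = 1%:M by rewrite mulVmx.
rewrite -[invmx _]vsubmxK -/U mul_col_row (@scalar_mx_block _ p p) => /eq_block_mx [UE UG _ _].
have Uf : row_free U.
  by apply/row_freeP; exists E; rewrite UE.
have Ub := eqmx_schmidt_free Uf.
have /submxP [D bD] : (schmidt U <= U)%MS by rewrite Ub.
have /submxP [D' UD] : (U <= schmidt U)%MS by rewrite Ub.
exists (schmidt U); split.
- by apply/unitarymxP/schmidt_unitarymx; rewrite leq_addr.
- by rewrite bD -mulmxA UG mulmx0.
- have : D' *m (schmidt U *m E) = 1%:M by rewrite mulmxA -UD.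
  by move=> /mulmx1_unit [].
Qed.

(** The invertibility of [E g(i)] is the induction invariant: it makes b E invertible and is
    reproduced with the adjoint of b in the place of E. *)
Lemma Weyl_step (E : 'M[K]_(p + p, p)) (g : K -> 'M[K]_(p + p, p)) :
  analytic_mx g 'i -> row_mx E (g 'i) \in unitmx ->
  exists (b : 'M[K]_(p, p + p)) g', [/\ b *m b ^t* = 1%:M, b *m E \in unitmx,
    analytic_mx g' 'i, row_mx (b ^t*) (g' 'i) \in unitmx &
    \forall l \near 'i, (l *: 1%:M + 'i *: reflection b) *m g' l = (l + 'i) *: g l].
Proof.
move=> ga Zu; have [b [bb bG bE]] := orthonormal_annihilator Zu.
have [a fa] := analytic_mx_mulr b ga.
have [q [qa _ qE]] := analytic_mx_divide fa bG.
(* On the range of the projection, (l + i)(l + i C)^-1 acts as (l + i) / (l - i) = 1 + 2i / (l - i),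
   and elsewhere as 1; q is b g / (l - i). *)
exists b, (fun l => g l + ((2%:R * 'i) *: b ^t*) *m q l); split => //.
- by apply: analytic_mxD => //; exact: analytic_mx_mulr.
- set s := q 'i; pose W := dsubmx (invmx (row_mx E (g 'i))).
  have WG : W *m g 'i = 1%:M.
    have : invmx (row_mx E (g 'i)) *m row_mx E (g 'i) = 1%:M by rewrite mulVmx.
    by rewrite -[invmx _]vsubmxK mul_col_row (@scalar_mx_block _ p p) => /eq_block_mx [].
  (* An explicit inverse: r2 is W corrected to kill the adjoint of b, and r1 is b corrected to kill
     g'(i). *)
  pose r2 := W - W *m b ^t* *m b.
  have r2b : r2 *m b ^t* = 0 by rewrite mulmxBl -[W *m _ *m b *m _]mulmxA bb mulmx1 subrr.
  have r2G : r2 *m g 'i = 1%:M by rewrite mulmxBl -[W *m _ *m b *m _]mulmxA bG mulmx0 subr0.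
  pose r1 := b - (2%:R * 'i) *: (s *m r2).
  have r1b : r1 *m b ^t* = 1%:M.
    by rewrite mulmxBl bb -scalemxAl -mulmxA r2b mulmx0 scaler0 subr0.
  have r1G : r1 *m g 'i = - ((2%:R * 'i) *: s).
    by rewrite mulmxBl bG -scalemxAl -mulmxA r2G mulmx1 sub0r.
  have : col_mx r1 r2 *m row_mx (b ^t*) (g 'i + (2%:R * 'i) *: b ^t* *m s) = 1%:M.
    rewrite mul_col_row (@scalar_mx_block _ p p) !mulmxDr -!scalemxAl -!scalemxAr.
    by rewrite !mulmxA r1b r2b r1G r2G mul0mx mul1mx scaler0 addr0 addNr.
  by move=> /mulmx1_unit [].
near=> l; have E1 : b *m g l = (l - 'i) *: q l by near: l.
have -> : l *: 1%:M + 'i *: reflection b = (l + 'i) *: 1%:M - (2%:R * 'i) *: (b ^t* *m b).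
  by apply/matrixP => i j; rewrite !mxE; ring.
rewrite mulmxDr mulmxBl -!scalemxAl mul1mx -mulmxA E1 -[RHS]addr0 -addrA; congr (_ + _).
rewrite mulmxBl -!scalemxAr -!scalemxAl mul1mx -(mulmxA _ b) (mulmxA b) bb mul1mx.
set M := b ^t* *m q l; rewrite !scalerA -scalerBl -scaleNr -scalerDl.
rewrite (_ : _ + _ = 0) ?scale0r//.
have i2 : 'i * 'i = -1 :> K by rewrite -expr2 sqrCi.
by ring: i2.
Unshelve. all: end_near. Qed.

Lemma right_prod_shift (C : nat -> 'M[K]_(p + p)) k l :
  right_prod C k.+1 l =
  (l *: 1%:M + 'i *: C 0) *m right_prod (fun j => C j.+1) k l.
Proof.
elim: k => [|k IH]; first by rewrite /= mul1mx mulmx1.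
by rewrite [LHS]/= -/(right_prod C k.+1 l) IH /= mulmxA.
Qed.

(** E is kept arbitrary because it changes along the induction: after the first step it is the
    adjoint of the preceding b. *)
Lemma Weyl_factorization m (E : 'M[K]_(p + p, p)) (g : K -> 'M[K]_(p + p, p)) :
  analytic_mx g 'i -> row_mx E (g 'i) \in unitmx ->
  exists b : nat -> 'M[K]_(p, p + p), [/\ forall k, (k < m)%N -> b k *m (b k) ^t* = 1%:M,
    (0 < m)%N -> b 0 *m E \in unitmx,
    forall k, (k.+1 < m)%N -> b k.+1 *m (b k) ^t* \in unitmx &
    exists2 Y, analytic_mx Y 'i & \forall l \near 'i,
      right_prod (fun k => reflection (b k)) m l *m Y l = (l + 'i) ^+ m *: g l].
Proof.
elim: m E g => [|m IH] E g ga Zu.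
  exists (fun=> 0); split => //; exists g => //.
  by near=> l; rewrite /= mul1mx expr0 scale1r.
have [b0 [g' [b0U b0E g'a Z'u g'E]]] := Weyl_step ga Zu.
have [b [bU bE bb [Y Ya YE]]] := IH _ _ g'a Z'u.
exists (fun k => if k is k'.+1 then b k' else b0); split => //.
- by case.
- by case=> [|k]; [exact: bE|exact: bb].
exists Y => //; near=> l; rewrite right_prod_shift -mulmxA.
have -> : right_prod (fun j => reflection (b j)) m l *m Y l = (l + 'i) ^+ m *: g' l by near: l.
rewrite -scalemxAr.
have -> : (l *: 1%:M + 'i *: reflection b0) *m g' l = (l + 'i) *: g l.
  by near: l.
by rewrite scalerA exprSr.
Unshelve. all: end_near. Qed.

Lemma Weyl_realization n (phi : K -> 'M[K]_p) : analytic_at phi 'i ->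
  exists C b, conditions_D n C b /\ weyl_function n C phi.
Proof.
move=> phia.
have ga : analytic_mx (fun l => col_mx (phi l) (1%:M : 'M[K]_p)) 'i.
  by apply: analytic_col_mx => //; exact: analytic_mx_cst.
(* The choice E = [1; 0] makes b_0 E equal to beta_1(0), and [E g(i)] is then unitriangular. *)
have Zu : row_mx (col_mx 1%:M (0 : 'M[K]_p)) (col_mx (phi 'i) 1%:M) \in unitmx.
  by rewrite unitmxE -block_mxEh det_ublock !det1 mulr1 unitr1.
have [b [bU bE bb [Y Ya YE]]] := Weyl_factorization n.+1 ga Zu.
exists (fun k => reflection (b k)), b; split.
  split.
  - move=> k kn; rewrite reflection_trmxC; split => //.
      by have [] := involution_inv (reflection_involutive (bU k kn)).
    by have [] := involution_inv (reflection_involutive (bU k kn)).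
  - by move=> k kn; split; [|exact: bU].
  - have := bE isT; rewrite -[b 0]hsubmxK mul_row_col mulmx1 mulmx0 addr0 unitmxE unitfE; exact.
  - case=> // k kn; have := bb k kn; rewrite unitmxE unitfE /=.
    (* Conditions (D) concern the adjoint of the product that is known to be invertible. *)
    apply: contraNneq => d0; rewrite -[_ *m _]trmxCK trmxC_mul trmxCK det_map_mx det_tr.
    by rewrite d0 rmorph0.
by apply: weyl_of_factorization Ya YE => k _; exact: reflection_trmxC.
Qed.

End Construction.

(** * Weyl functions and Taylor expansions *)

Section Correspondence.
Variables (K : numClosedFieldType) (p : nat).

(** A Lipschitz bound at one point suffices to change variables, in both directions of the Cayley
    transform. *)
Lemma near_comp (f : K -> K) z0 w0 c (P : K -> Prop) : 0 <= c ->
  (\forall z \near z0, `|f z - w0| <= c * `|z - z0|) ->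
  (\forall w \near w0, P w) -> \forall z \near z0, P (f z).
Proof.
move=> c0 fc /nbhs_ballP [e /= e0 eP]; have c1 : 0 < c + 1 by rewrite ltr_wpDl.
near=> z; apply: eP; rewrite /ball /= distrC.
apply: (@le_lt_trans _ _ (c * `|z - z0|)); first by near: z.
have : `|z - z0| <= e / 2 / (c + 1) by near: z; apply: near_dist_le; rewrite !divr_gt0.
move=> H; apply: (@le_lt_trans _ _ (e / 2)); last by rewrite ltr_pdivrMr// ltr_pMr// ltr1n.
apply: (@le_trans _ _ ((c + 1) * `|z - z0|)); first by rewrite ler_wpM2r// lerDl.
by rewrite mulrC -ler_pdivlMr.
Unshelve. all: end_near. Qed.

Lemma order_ge_comp m q k (g : K -> 'M[K]_(m, q)) (f : K -> K) z0 w0 c : 0 <= c ->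
  (\forall z \near z0, `|f z - w0| <= c * `|z - z0|) ->
  order_ge k g w0 -> order_ge k (fun z => g (f z)) z0.
Proof.
move=> c0 fc [d d0 gd]; exists (d * c ^+ k); first by rewrite mulr_ge0 ?exprn_ge0.
near=> z; apply: (@le_trans _ _ (d * `|f z - w0| ^+ k)).
  by near: z; exact: (near_comp c0 fc gd).
rewrite -mulrA ler_wpM2l// -exprMn lerXn2r ?nnegrE ?mulr_ge0//.
by near: z.
Unshelve. all: end_near. Qed.

Lemma order_ge_exprZ m q k (f : K -> 'M[K]_(m, q)) z0 :
  order_ge 0 f z0 -> order_ge k (fun z => (z - z0) ^+ k *: f z) z0.
Proof.
move=> [c c0 fc]; exists c => //; near=> z.
rewrite normrZ normrX mulrC ler_wpM2r ?exprn_ge0//.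
by rewrite -[c]mulr1 -(expr0 `|z - z0|); near: z.
Unshelve. all: end_near. Qed.

Lemma analytic_shift_exprZ m q k (a : K) (f : K -> 'M[K]_(m, q)) z0 :
  analytic_mx f z0 -> analytic_mx (fun z => (z + a) ^+ k *: f z) z0.
Proof.
move=> fa; elim: k => [|k IH].
  by apply: analytic_mx_ext fa => z; rewrite expr0 scale1r.
apply: analytic_mx_ext (analytic_mx_affine 1%:M (a *: 1%:M) IH) => z.
by rewrite -scalerDl -scalemxAl mul1mx scalerA exprS.
Qed.

Definition cayley (z : K) : K := 'i * ((1 + z) / (1 - z)).
Definition cayley_inv (l : K) : K := (l - 'i) / (l + 'i).

Lemma cayley_near : \forall z \near 0, `|cayley z - 'i| <= 4 * `|z - 0|.
Proof.
near=> z; rewrite subr0.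
have z2 : `|z| <= 1 / 2 by rewrite -[z]subr0; near: z; apply: near_dist_le.
have z1 : 1 / 2 <= `|1 - z|.
  apply: le_trans (lerB_dist _ _); rewrite normr1 lerBrDr -lerBrDl.
  by rewrite (_ : 1 - 1 / 2 = 1 / 2 :> K)//; field.
have nz : 1 - z != 0 by rewrite -normr_gt0 (lt_le_trans _ z1).
have -> : cayley z - 'i = 2%:R * 'i * z / (1 - z) by rewrite /cayley; field.
rewrite !normrM normfV normCi normr_nat mulr1 ler_pdivrMr ?normr_gt0//.
apply: (@le_trans _ _ (4 * `|z| * (1 / 2))); last by rewrite ler_wpM2l ?mulr_ge0.
by rewrite (_ : 4 * `|z| * (1 / 2) = 2 * `|z|)//; field.
Unshelve. all: end_near. Qed.

Lemma near_i_addi : \forall l \near 'i, 1 <= `|l + 'i| :> K.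
Proof.
near=> l; have l1 : `|l - 'i| <= 1 by near: l; exact: near_dist_le.
have -> : l + 'i = 2%:R * 'i + (l - 'i) by ring.
have : `|2%:R * 'i : K| <= `|2%:R * 'i + (l - 'i)| + `|l - 'i|.
  by rewrite -{1}[2%:R * 'i](addrK (l - 'i)) ler_normB.
rewrite normrM normCi normr_nat mulr1 => H; rewrite -(lerD2r `|l - 'i|).
by apply: le_trans H; rewrite -[2%:R]/(1 + 1) lerD2l.
Unshelve. all: end_near. Qed.

Lemma cayley_inv_near : \forall l \near 'i, `|cayley_inv l - 0| <= 1 * `|l - 'i|.
Proof.
near=> l; have l1 : 1 <= `|l + 'i| by near: l; exact: near_i_addi.
rewrite subr0 mul1r /cayley_inv normrM normfV ler_pdivrMr; last exact: lt_le_trans l1.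
by rewrite ler_peMr.
Unshelve. all: end_near. Qed.

Lemma cayleyK z : z != 1 -> cayley_inv (cayley z) = z.
Proof.
move=> z1; have nz : 1 - z != 0 by rewrite subr_eq0 eq_sym.
have i0 := neq0Ci K; have two : (2%:R : K) != 0 by rewrite pnatr_eq0.
rewrite /cayley_inv.
have -> : cayley z - 'i = (2%:R * 'i) / (1 - z) * z by rewrite /cayley; field.
have -> : cayley z + 'i = (2%:R * 'i) / (1 - z) by rewrite /cayley; field.
by rewrite mulrAC divff ?mul1r// mulf_neq0 ?invr_eq0// mulf_neq0.
Qed.

Lemma cayley_invK l : l + 'i != 0 -> cayley (cayley_inv l) = l.
Proof.
move=> li; have i0 := neq0Ci K; have two : (2%:R : K) != 0 by rewrite pnatr_eq0.
rewrite /cayley.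
have -> : 1 + cayley_inv l = 2%:R * l / (l + 'i) by rewrite /cayley_inv; field.
have -> : 1 - cayley_inv l = 2%:R * 'i / (l + 'i) by rewrite /cayley_inv; field.
by field; rewrite li i0.
Qed.

(** * Weyl functions and the defect from the psi polynomial *)

Section System.
Variables (n : nat) (C : nat -> 'M[K]_(p + p)) (beta : nat -> 'M[K]_(p, p + p)).
Hypothesis CD : conditions_D n C beta.

Let CH k : (k <= n)%N -> (C k) ^t* = C k.
Proof. by case: CD => H _ _ _ kn; have [<- _ _] := H k kn. Qed.

Let CC k : (k <= n)%N -> C k *m C k = 1%:M.
Proof. by case: CD => H _ _ _ kn; have [_ Cu {2}->] := H k kn; rewrite mulmxV. Qed.

Let CE k : (k <= n)%N -> C k = 1%:M - 2%:R *: ((beta k) ^t* *m beta k).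
Proof. by case: CD => _ H _ _ kn; have [] := H k kn. Qed.

Let betaU k : (k <= n)%N -> beta k *m (beta k) ^t* = 1%:M.
Proof. by case: CD => _ H _ _ kn; have [] := H k kn. Qed.

Lemma vminus_unit k : (k <= n)%N -> vminus beta k \in unitmx.
Proof.
case: CD => _ _ b0 bk; elim: k => [|k IH] kn; first by rewrite unitmxE unitfE.
rewrite /= unitmx_mul IH ?(ltnW kn)// andbT unitmxE unitfE.
have := bk k.+1 kn; apply: contraNneq => d0.
by rewrite /= -[_ *m _]trmxCK trmxC_mul trmxCK det_map_mx det_tr d0 rmorph0.
Qed.

(** At l = i each factor l - i C_j becomes 2i P_j, so the product telescopes into the recursion of
    [vminus]. *)
Lemma left_prod_at_i k : (k <= n)%N ->
  beta k *m left_prod C k 'i *m col_mx 1%:M 0 = (2%:R * 'i) ^+ k *: vminus beta k.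
Proof.
elim: k => [|k IH] kn /=.
  by rewrite mulmx1 expr0 scale1r -{1}[beta 0]hsubmxK mul_row_col mulmx1 mulmx0 addr0.
have -> : 'i *: 1%:M + - 'i *: C k = (2%:R * 'i) *: ((beta k) ^t* *m beta k).
  by rewrite CE ?(ltnW kn)//; apply/matrixP => a b; rewrite !mxE; ring.
rewrite -!mulmxA -!scalemxAl -scalemxAr -mulmxA (mulmxA (beta k)) IH ?(ltnW kn)//.
by rewrite -!scalemxAr scalerA exprS mulmxA.
Qed.

Lemma beta_refl k : (k <= n)%N -> beta k *m C k = - beta k.
Proof.
move=> kn; rewrite CE// mulmxBr mulmx1 -scalemxAr mulmxA betaU// mul1mx.
by apply/matrixP => a b; rewrite !mxE; ring.
Qed.

Definition psi_defect (phi : K -> 'M[K]_p) (l : K) : 'M[K]_p :=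
  phi l - psi_poly n (psi beta n) (cayley_inv l).

Lemma exists_interpolant : exists2 h : K -> 'M[K]_(p + p, p),
  order_ge 0 h 'i & forall l, l + 'i != 0 -> right_prod C n.+1 l *m h l =
    (l + 'i) ^+ n.+1 *: col_mx (psi_poly n (psi beta n) (cayley_inv l)) 1%:M.
Proof.
have [v [VE vR]] := Vminus_blocks beta n.
have psiR := psi_relation VE vR vminus_unit.
exists (fun l => interpolant beta n v (psi beta n) n.+1 (cayley_inv l)).
  apply: (order_ge_comp ler01 cayley_inv_near).
  by apply: analytic_mx_bounded; exact: analytic_interpolant.
by move=> l li; exact: (right_prod_interpolant vR psiR betaU CE li).
Qed.

Lemma near_i_addi_neq0 : \forall l \near 'i, l + 'i != 0 :> K.
Proof.
near=> l; rewrite -normr_gt0 (@lt_le_trans _ _ 1)//.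
by near: l; exact: near_i_addi.
Unshelve. all: end_near. Qed.

Lemma weyl_expansionP (phi : K -> 'M[K]_p) :
  weyl_expansion n beta phi <-> order_ge n.+1 (psi_defect phi) 'i.
Proof.
have defE z : z != 1 ->
    psi_defect phi (cayley z) = cayley_comp phi z - psi_poly n (psi beta n) z.
  by move=> z1; rewrite /psi_defect cayleyK.
rewrite /weyl_expansion; split.
  move=> /eqO_exP [c c0 H].
  have : order_ge n.+1 (fun z => cayley_comp phi z - psi_poly n (psi beta n) z) 0.
    exists c; first exact: ltW.
    by near=> z; rewrite subr0 -normrX; near: z.
  move=> /(order_ge_comp ler01 cayley_inv_near); apply: order_ge_near.
  near=> l; have li : l + 'i != 0 by near: l; exact: near_i_addi_neq0.
  by rewrite /psi_defect /cayley_comp -/(cayley (cayley_inv l)) cayley_invK.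
move=> /(order_ge_comp (ler0n _ 4) cayley_near) [c c0 H].
apply/eqO_exP; exists (c + 1); first by rewrite ltr_wpDl.
near=> z; have z1 : z != 1.
  have : `|z - 0| <= 1 / 2 by near: z; apply: near_dist_le.
  apply: contraTneq => ->; rewrite subr0 normr1 lt_geF//.
  by rewrite ltr_pdivrMr// mul1r ltr1n.
rewrite normrX; apply: (@le_trans _ _ (c * `|z - 0| ^+ n.+1)).
  by have := defE z z1; rewrite /psi_poly => <-; near: z.
by rewrite subr0 ler_wpM2r ?exprn_ge0// lerDl.
Unshelve. all: end_near. Qed.

Lemma analytic_col_phi (phi : K -> 'M[K]_p) : analytic_at phi 'i ->
  analytic_mx (fun l => col_mx (phi l) (1%:M : 'M[K]_p)) 'i.
Proof. by move=> phia; apply: analytic_col_mx => //; exact: analytic_mx_cst. Qed.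

(** Split [phi; 1] as [defect; 0] + [psi_poly; 1]. The left product sends the second summand to (l -
    i)^(n+1) h and the first is already of order n + 1; the quotient by (l - i)^(n+1) is the
    required Y. *)
Lemma defect_weyl (phi : K -> 'M[K]_p) : analytic_at phi 'i ->
  order_ge n.+1 (psi_defect phi) 'i -> weyl_function n C phi.
Proof.
move=> phia dO; have ga := analytic_col_phi phia.
have [h hb hE] := exists_interpolant.
have fa := analytic_left_prod C n.+1 ga.
have fO : order_ge n.+1 (fun l => left_prod C n.+1 l *m col_mx (phi l) 1%:M) 'i.
  have La := analytic_left_prod C n.+1 (analytic_mx_cst (col_mx 1%:M 0 : 'M[K]_(p + p, p)) 'i).
  have := order_geD (order_ge_mul (analytic_mx_bounded La) dO) (order_ge_exprZ n.+1 hb).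
  apply: order_ge_near; near=> l.
  have li : l + 'i != 0 by near: l; exact: near_i_addi_neq0.
  have -> : (l - 'i) ^+ n.+1 *: h l =
      left_prod C n.+1 l *m col_mx (psi_poly n (psi beta n) (cayley_inv l)) 1%:M.
    apply: (scalerI (expf_neq0 n.+1 li)); rewrite scalemxAr -hE// mulmxA.
    rewrite left_right_prod; last by move=> j; exact: CC.
    by rewrite -scalemxAl mul1mx scalerA exprMn mulrC.
  rewrite -mulmxA -mulmxDr mul_col_mx mul1mx mul0mx add_col_mx add0r.
  by rewrite subrK.
have [Y Ya YE] := order_ge_divide fa fO.
apply: (weyl_of_factorization CH Ya).
(* The power of l - i can be cancelled only off l = i; analyticity supplies the identity at i. *)
apply: analytic_mx_eq; first exact: analytic_right_prod.
  exact: analytic_shift_exprZ.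
near=> l => l0; have E : left_prod C n.+1 l *m col_mx (phi l) 1%:M =
  (l - 'i) ^+ n.+1 *: Y l by near: l.
have l1 : (l - 'i) ^+ n.+1 != 0 by rewrite expf_neq0// subr_eq0.
apply: (scalerI l1); rewrite scalemxAr -E mulmxA right_left_prod; last by move=> j; exact: CC.
by rewrite -scalemxAl mul1mx scalerA exprMn.
Unshelve. all: end_near. Qed.

Lemma weyl_defect (phi : K -> 'M[K]_p) :
  weyl_function n C phi -> order_ge n.+1 (psi_defect phi) 'i.
Proof.
move=> /(weyl_functionP _ CH) [Y [Ya Du YE]].
have [h hb hE] := exists_interpolant.
pose D l := dsubmx (right_prod C n.+1 l *m Y l).
have Da : analytic_mx D 'i := analytic_dsubmx (analytic_right_prod C n.+1 Ya).
have Dn := near_unitmx Da Du.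
have invDb : order_ge 0 (fun l => invmx (D l)) 'i.
  apply: (order_ge_cancel Da Du).
  apply: order_ge_near (analytic_mx_bounded (analytic_mx_cst 1%:M 'i)).
  by near=> l; rewrite mulmxV//; near: l.
pose U l := beta n *m (left_prod C n.+1 l *m col_mx 1%:M (0 : 'M[K]_p)).
have Ua : analytic_mx U 'i.
  by apply: analytic_mx_mulr; apply: analytic_left_prod; exact: analytic_mx_cst.
have Uu : U 'i \in unitmx.
  rewrite /U /= mulmxA (mulmxA (beta n)) mulmxDr -!scalemxAr mulmx1 beta_refl//.
  rewrite scaleNr scalerN opprK -scalerDl -!scalemxAl left_prod_at_i//.
  have ii : ('i + 'i : K) != 0 by rewrite -mulr2n mulrn_eq0 neq0Ci.
  rewrite !unitmxZ ?vminus_unit// unitfE ?expf_neq0//.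
  by rewrite mulf_neq0 ?neq0Ci ?pnatr_eq0.
have dDO : order_ge n.+1 (fun l => psi_defect phi l *m D l) 'i.
  (* The product U defect D equals (l - i)^(n+1) beta(n) ((l + i)^(n+1) Y - h D), where the last
     factor is bounded near i. *)
  apply: (order_ge_cancel Ua Uu).
  have e1 := analytic_mx_bounded (analytic_shift_exprZ n.+1 'i Ya).
  have e2 := order_ge_mul hb (analytic_mx_bounded (analytic_mx_mulr (- 1%:M) Da)).
  have e3 := analytic_mx_bounded (analytic_mx_cst (beta n) 'i).
  have := order_ge_exprZ n.+1 (order_ge_mul e3 (order_geD e1 e2)).
  apply: order_ge_near; near=> l.
  have li : l + 'i != 0 by near: l; exact: near_i_addi_neq0.
  have E : right_prod C n.+1 l *m Y l = col_mx (phi l) 1%:M *m D l by near: l.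
  apply: (scalerI (expf_neq0 n.+1 li)); rewrite scalerA -exprMn [(l + _) * _]mulrC.
  (* Left multiplication by beta n *m left_prod turns the factorization of the defect
     through right_prod into a bound of order n + 1. *)
  have LR (X : 'M[K]_(p + p, p)) : ((l - 'i) * (l + 'i)) ^+ n.+1 *: (beta n *m X) =
      beta n *m (left_prod C n.+1 l *m (right_prod C n.+1 l *m X)).
    rewrite (mulmxA (left_prod _ _ _)) left_right_prod; last by move=> j; exact: CC.
    by rewrite -scalemxAl mul1mx scalemxAr.
  rewrite LR mulmxDr -scalemxAr E (mulmxA _ (h l)) hE// mulNmx mul1mx mulmxN.
  rewrite -scalemxAl -scalerBr -mulmxBl opp_col_mx add_col_mx subrr.
  rewrite /U; move: (left_prod C n.+1 l) => L; rewrite -!mulmxA -!scalemxAr.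
  congr (_ *: (_ *m (_ *m _))).
  by rewrite [RHS]mulmxA [col_mx 1%:M 0 *m _]mul_col_mx mul1mx mul0mx.
have := order_ge_mul dDO invDb; rewrite addn0; apply: order_ge_near.
by near=> l; rewrite mulmxK//; near: l.
Unshelve. all: end_near. Qed.

End System.
End Correspondence.

Theorem theorem3p7 (R : realType) (n p : nat) (hp : (0 < p)%N) :
  (forall (C : nat -> 'M[R[i]]_(p + p)) (beta : nat -> 'M[R[i]]_(p, p + p)),
     conditions_D n C beta ->
     forall phi : R[i] -> 'M[R[i]]_p, analytic_at phi 'i ->
       (weyl_function n C phi <-> weyl_expansion n beta phi))
  /\
  (forall phi : R[i] -> 'M[R[i]]_p, analytic_at phi 'i ->
     exists S : 'M[R[i]]_(\sum_(i < n.+1) p),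
       [/\ S_identity (taylor_coef (cayley_comp phi) 0) S,
           forall S', S_identity (taylor_coef (cayley_comp phi) 0) S' -> S' = S
         & (exists (C : nat -> 'M[R[i]]_(p + p))
                   (beta : nat -> 'M[R[i]]_(p, p + p)),
              conditions_D n C beta /\ weyl_function n C phi)
           <-> S \in unitmx]).
Proof.
split.
  move=> C beta CD phi phia; split.
    by move=> /(weyl_defect CD) /weyl_expansionP.
  by move=> /weyl_expansionP; exact: defect_weyl.
move=> phi phia; set a := taylor_coef _ _.
have [S SE] := Sylvester_surj ('i *: (Pi n a *m (Pi n a) ^t*)).
exists S; split => //.
  move=> S' S'E; apply/eqP; rewrite -subr_eq0; apply/eqP/Sylvester_inj.
  move: S'E; rewrite /S_identity -SE => /eqP; rewrite subr_eq => /eqP E.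
  by rewrite mulmxBr mulmxBl E addrAC [_ - _ - _ *m S]addrAC subrr add0r addrC.
split=> _; first exact: S_identity_unit SE.
exact: Weyl_realization.
Qed.
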